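(* Let $F: \mathcal{C} \to \mathcal{D}$ be a tensor functor between tensor categories $\mathcal{C}$ and $\mathcal{D}$ over a field $k$, and suppose that it has a left adjoint $L$ and a right adjoint $R$. Then the following assertions are equivalent: (1) $L$ has a left adjoint. (2) $R$ has a right adjoint. (3) There exists an object $\chi_F \in \mathcal{D}$ such that $R \cong L(- \otimes \chi_F)$. Such an object $\chi_F \in \mathcal{D}$ is unique up to isomorphism if it exists. More precisely, if the equivalent conditions (1), (2) and (3) hold, then there are isomorphisms $$E(\mathbf{1}) \cong \chi_F \cong {}^*G(\mathbf{1}), \quad \text{where } E \dashv L \dashv F \dashv R \dashv G.$$ If, moreover, $\mathcal{C}$ and $\mathcal{D}$ are finite tensor categories over $k$, then the three conditions (1), (2) and (3) are equivalent to each of the following three conditions: (4) $L$ is exact. (5) $R$ is exact. (6) $F(P)$ is projective for every projective object $P \in \mathcal{C}$.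
   Context: $k$ is an arbitrary field. A tensor category is a $k$-linear abelian category endowed with a rigid monoidal structure whose tensor product is $k$-bilinear (the unit object $\mathbf{1}$ is not assumed simple). A finite tensor category is a tensor category whose underlying category is finite, i.e. $k$-linearly equivalent to the category of finite-dimensional right modules over a finite-dimensional $k$-algebra. A tensor functor is a $k$-linear strong monoidal functor between tensor categories. The left dual $X^*$ of $X$ comes with $X^* \otimes X \to \mathbf{1}$ and $\mathbf{1} \to X \otimes X^*$; ${}^*X$ is the right dual, so that $X$ is a left dual of ${}^*X$. $P \dashv Q$ means $P$ is left adjoint to $Q$. *)

(* Defs.v *)
From HB Require Import structures.
From mathcomp Require Import all_boot all_algebra.
From mathcomp Require Import boolp.

Set Implicit Arguments.
Unset Strict Implicit.
Unset Printing Implicit Defensive.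

Import GRing.Theory.
Local Open Scope ring_scope.

Declare Scope cat_scope.
Delimit Scope cat_scope with cat.
Local Open Scope cat_scope.

Reserved Notation "g '\oc' f" (at level 40, left associativity).
Reserved Notation "G '\oF' F" (at level 40, left associativity).

(* All categories are k-linear; functors and natural transformations are the
   ordinary ones, with k-linearity of a functor as a separate predicate. *)

Record lincat (k : fieldType) := LinCat {
  ob :> Type;
  hom : ob -> ob -> lmodType k;
  idm : forall X : ob, hom X X;
  comp : forall X Y Z : ob, hom Y Z -> hom X Y -> hom X Z;
  comp1m : forall (X Y : ob) (f : hom X Y), comp (idm Y) f = f;
  compm1 : forall (X Y : ob) (f : hom X Y), comp f (idm X) = f;
  compA : forall (X Y Z W : ob) (h : hom Z W) (g : hom Y Z) (f : hom X Y),
    comp h (comp g f) = comp (comp h g) f;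
  comp_linearl : forall (X Y Z : ob) (f : hom X Y),
    linear (fun g : hom Y Z => comp g f);
  comp_linearr : forall (X Y Z : ob) (g : hom Y Z),
    linear (fun f : hom X Y => comp g f)
}.

Arguments idm {k _} X.

Notation "g '\oc' f" := (comp g f) : cat_scope.

Section Category.
Variables (k : fieldType) (C : lincat k).
Implicit Types X Y Z W : C.

Record iso X Y := Iso {
  isof :> hom X Y;
  isov : hom Y X;
  isofK : isov \oc isof = idm X;
  isovK : isof \oc isov = idm Y
}.

Definition isomorphic X Y : Prop := inhabited (iso X Y).

Definition mono X Y (f : hom X Y) : Prop :=
  forall W (g h : hom W X), f \oc g = f \oc h -> g = h.

Definition epi X Y (f : hom X Y) : Prop :=
  forall W (g h : hom Y W), g \oc f = h \oc f -> g = h.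

Definition is_zero X : Prop :=
  forall Y, (forall f : hom X Y, f = 0) /\ (forall f : hom Y X, f = 0).

Definition is_kernel X Y K (f : hom X Y) (i : hom K X) : Prop :=
  f \oc i = 0 /\
  forall W (g : hom W X), f \oc g = 0 -> exists! h : hom W K, i \oc h = g.

Definition is_cokernel X Y Q (f : hom X Y) (p : hom Y Q) : Prop :=
  p \oc f = 0 /\
  forall W (g : hom Y W), g \oc f = 0 -> exists! h : hom Q W, h \oc p = g.

Definition is_biproduct X Y P
    (i1 : hom X P) (i2 : hom Y P) (p1 : hom P X) (p2 : hom P Y) : Prop :=
  [/\ p1 \oc i1 = idm X, p2 \oc i2 = idm Y, p1 \oc i2 = 0, p2 \oc i1 = 0 &
      i1 \oc p1 + i2 \oc p2 = idm P].

Record abelian : Prop := Abelian {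
  ab_zero : exists Z, is_zero Z;
  ab_biprod : forall X Y, exists P (i1 : hom X P) (i2 : hom Y P)
    (p1 : hom P X) (p2 : hom P Y), is_biproduct i1 i2 p1 p2;
  ab_ker : forall X Y (f : hom X Y), exists K (i : hom K X), is_kernel f i;
  ab_coker : forall X Y (f : hom X Y), exists Q (p : hom Y Q), is_cokernel f p;
  ab_mono : forall X Y (f : hom X Y), mono f ->
    exists Z (g : hom Y Z), is_kernel g f;
  ab_epi : forall X Y (f : hom X Y), epi f ->
    exists Z (g : hom Z X), is_cokernel g f
}.

(* 0 -> X -> Y -> Z -> 0 is exact. *)
Definition short_exact X Y Z (f : hom X Y) (g : hom Y Z) : Prop :=
  is_kernel g f /\ is_cokernel f g.

Definition projective P : Prop :=
  forall X Y (g : hom X Y) (f : hom P Y), epi g ->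
    exists h : hom P X, g \oc h = f.

End Category.

Record functor (k : fieldType) (C D : lincat k) := Functor {
  fob :> C -> D;
  fmap : forall X Y : C, hom X Y -> hom (fob X) (fob Y);
  fmap1 : forall X : C, fmap (idm X) = idm (fob X);
  fmapM : forall (X Y Z : C) (g : hom Y Z) (f : hom X Y),
    fmap (g \oc f) = fmap g \oc fmap f
}.

Arguments fmap {k C D} _ {X Y}.

Section Functors.
Variables (k : fieldType).
Implicit Types C D : lincat k.

Definition functor_id C : functor C C :=
  @Functor k C C (fun X => X) (fun X Y f => f)
    (fun X => erefl) (fun X Y Z g f => erefl).

Section Comp.
Variables (C D E : lincat k) (G : functor D E) (F : functor C D).
Fact fcomp1 X : fmap G (fmap F (idm X)) = idm (G (F X)).
Proof. by rewrite !fmap1. Qed.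
Fact fcompM X Y Z (g : hom Y Z) (f : hom X Y) :
  fmap G (fmap F (g \oc f)) = fmap G (fmap F g) \oc fmap G (fmap F f).
Proof. by rewrite !fmapM. Qed.
Definition functor_comp : functor C E :=
  @Functor k C E (fun X => G (F X)) (fun X Y f => fmap G (fmap F f))
    fcomp1 fcompM.
End Comp.

Definition linear_functor C D (F : functor C D) : Prop :=
  forall X Y : C, linear (fun f : hom X Y => fmap F f).

Definition additive_functor C D (F : functor C D) : Prop :=
  forall (X Y : C) (f g : hom X Y), fmap F (f + g) = fmap F f + fmap F g.

Definition exact_functor C D (F : functor C D) : Prop :=
  additive_functor F /\
  forall (X Y Z : C) (f : hom X Y) (g : hom Y Z),
    short_exact f g -> short_exact (fmap F f) (fmap F g).

Record natiso C D (F G : functor C D) := NatIso {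
  niso :> forall X : C, iso (F X) (G X);
  niso_nat : forall (X Y : C) (f : hom X Y),
    niso Y \oc fmap F f = fmap G f \oc niso X
}.

(* adjunction P Q is P -| Q. *)
Record adjunction C D (P : functor C D) (Q : functor D C) := Adjunction {
  adj_unit : forall X : C, hom X (Q (P X));
  adj_counit : forall Y : D, hom (P (Q Y)) Y;
  adj_unit_nat : forall (X X' : C) (f : hom X X'),
    adj_unit X' \oc f = fmap Q (fmap P f) \oc adj_unit X;
  adj_counit_nat : forall (Y Y' : D) (g : hom Y Y'),
    adj_counit Y' \oc fmap P (fmap Q g) = g \oc adj_counit Y;
  adj_triangle_left : forall X : C,
    adj_counit (P X) \oc fmap P (adj_unit X) = idm (P X);
  adj_triangle_right : forall Y : D,
    fmap Q (adj_counit Y) \oc adj_unit (Q Y) = idm (Q Y)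
}.

Definition has_left_adjoint C D (Q : functor D C) : Prop :=
  exists P : functor C D, inhabited (adjunction P Q).

Definition has_right_adjoint C D (P : functor C D) : Prop :=
  exists Q : functor D C, inhabited (adjunction P Q).

Definition linear_equivalent C D : Prop :=
  exists (F : functor C D) (G : functor D C),
    [/\ linear_functor F,
        inhabited (natiso (functor_comp G F) (functor_id C)) &
        inhabited (natiso (functor_comp F G) (functor_id D))].

End Functors.

Notation "G '\oF' F" := (functor_comp G F) : cat_scope.

(* falgType excludes the zero algebra, whose module category is the (finite)
   zero tensor category; hence this record, in which 1 = 0 is allowed. *)
Record fdalg (k : fieldType) := FdAlg {
  fdalg_sort :> vectType k;
  amul : fdalg_sort -> fdalg_sort -> fdalg_sort;
  aone : fdalg_sort;
  amulA : forall a b c, amul a (amul b c) = amul (amul a b) c;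
  amul1a : forall a, amul aone a = a;
  amula1 : forall a, amul a aone = a;
  amul_linearl : forall b, linear (fun a => amul a b);
  amul_linearr : forall a, linear (amul a)
}.

Arguments aone {k _}.

Record fdmod (k : fieldType) (A : fdalg k) := FdMod {
  fdmod_sort :> vectType k;
  mact : fdmod_sort -> A -> fdmod_sort;
  mactA : forall m a b, mact (mact m a) b = mact m (amul a b);
  mact1 : forall m, mact m aone = m;
  mact_linearl : forall a, linear (fun m => mact m a);
  mact_linearr : forall m, linear (mact m)
}.

Section ModuleCategory.
Variables (k : fieldType) (A : fdalg k).

Definition modhom_pred (M N : fdmod A) : pred 'Hom(M, N) :=
  fun f => `[< forall (m : M) (a : A), f (mact m a) = mact (f m) a >].
Arguments modhom_pred : clear implicits.

Record modhom (M N : fdmod A) := ModHom {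
  modfun :> 'Hom(M, N);
  _ : modfun \in modhom_pred M N
}.

Section Modhom.
Variables (M N : fdmod A).

HB.instance Definition _ := [isSub for @modfun M N].
HB.instance Definition _ := [Choice of modhom M N by <:].

Lemma modhom_predP (f : 'Hom(M, N)) :
  reflect (forall m a, f (mact m a) = mact (f m) a) (f \in modhom_pred M N).
Proof. exact: asboolP. Qed.

Fact modhom_submod_closed : submod_closed (modhom_pred M N).
Proof.
have act_lin a : linear (fun n : N => mact n a) by exact: mact_linearl.
have act0 a : mact (0 : N) a = 0.
  by have := act_lin a (-1) 0 0; rewrite scaler0 addr0 scaleN1r addNr.
split=> [|c f g /modhom_predP hf /modhom_predP hg]; apply/modhom_predP=> m a.
  by rewrite !lfunE /= act0.
by rewrite !lfunE /= !lfunE /= hf hg act_lin.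
Qed.

HB.instance Definition _ :=
  GRing.isSubmodClosed.Build k _ (modhom_pred M N) modhom_submod_closed.
HB.instance Definition _ := [SubChoice_isSubLmodule of modhom M N by <:].

Lemma modhomP (f : modhom M N) m a : f (mact m a) = mact (f m) a.
Proof. by case: f => f /= /modhom_predP. Qed.

End Modhom.

Fact modid_subproof (M : fdmod A) : \1%VF \in modhom_pred M M.
Proof. by apply/modhom_predP=> m a; rewrite !id_lfunE. Qed.
Definition modid (M : fdmod A) : modhom M M := ModHom (modid_subproof M).

Fact modcomp_subproof (M N P : fdmod A) (g : modhom N P) (f : modhom M N) :
  (g \o f)%VF \in modhom_pred M P.
Proof. by apply/modhom_predP=> m a; rewrite !comp_lfunE !modhomP. Qed.
Definition modcomp (M N P : fdmod A) (g : modhom N P) (f : modhom M N) :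
  modhom M P := ModHom (modcomp_subproof g f).

Fact modcomp1m (M N : fdmod A) (f : modhom M N) : modcomp (modid N) f = f.
Proof. by apply: val_inj; rewrite /= comp_lfun1l. Qed.
Fact modcompm1 (M N : fdmod A) (f : modhom M N) : modcomp f (modid M) = f.
Proof. by apply: val_inj; rewrite /= comp_lfun1r. Qed.
Fact modcompA (M N P Q : fdmod A)
    (h : modhom P Q) (g : modhom N P) (f : modhom M N) :
  modcomp h (modcomp g f) = modcomp (modcomp h g) f.
Proof. by apply: val_inj; rewrite /= comp_lfunA. Qed.
Fact modcomp_linearl (M N P : fdmod A) (f : modhom M N) :
  linear (fun g : modhom N P => modcomp g f).
Proof.
by move=> c g h; apply: val_inj; rewrite /= comp_lfunDl comp_lfunZl.
Qed.
Fact modcomp_linearr (M N P : fdmod A) (g : modhom N P) :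
  linear (fun f : modhom M N => modcomp g f).
Proof.
by move=> c f h; apply: val_inj; rewrite /= comp_lfunDr comp_lfunZr.
Qed.

(* Finite-dimensional right A-modules. *)
Definition modcat : lincat k :=
  @LinCat k (fdmod A) (fun M N => modhom M N) modid modcomp
    modcomp1m modcompm1 modcompA modcomp_linearl modcomp_linearr.

End ModuleCategory.

Definition finite_category (k : fieldType) (C : lincat k) : Prop :=
  exists A : fdalg k, linear_equivalent C (modcat A).

Record monoidal (k : fieldType) (C : lincat k) := Monoidal {
  tens : C -> C -> C;
  tensm : forall X X' Y Y' : C,
    hom X X' -> hom Y Y' -> hom (tens X Y) (tens X' Y');
  tensm1 : forall X Y : C, tensm (idm X) (idm Y) = idm (tens X Y);
  tensmM : forall (X X' X'' Y Y' Y'' : C) (f' : hom X' X'') (f : hom X X')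
      (g' : hom Y' Y'') (g : hom Y Y'),
    tensm (f' \oc f) (g' \oc g) = tensm f' g' \oc tensm f g;
  munit : C;
  massoc : forall X Y Z : C, iso (tens (tens X Y) Z) (tens X (tens Y Z));
  mlunit : forall X : C, iso (tens munit X) X;
  mrunit : forall X : C, iso (tens X munit) X;
  massoc_nat : forall (X X' Y Y' Z Z' : C)
      (f : hom X X') (g : hom Y Y') (h : hom Z Z'),
    massoc X' Y' Z' \oc tensm (tensm f g) h =
    tensm f (tensm g h) \oc massoc X Y Z;
  mlunit_nat : forall (X X' : C) (f : hom X X'),
    mlunit X' \oc tensm (idm munit) f = f \oc mlunit X;
  mrunit_nat : forall (X X' : C) (f : hom X X'),
    mrunit X' \oc tensm f (idm munit) = f \oc mrunit X;
  mpentagon : forall W X Y Z : C,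
    massoc W X (tens Y Z) \oc massoc (tens W X) Y Z =
    tensm (idm W) (massoc X Y Z) \oc massoc W (tens X Y) Z
      \oc tensm (massoc W X Y) (idm Z);
  mtriangle : forall X Y : C,
    tensm (idm X) (mlunit Y) \oc massoc X munit Y = tensm (mrunit X) (idm Y)
}.

Arguments tensm {k C} _ {X X' Y Y'}.

Section Monoidal.
Variables (k : fieldType) (C : lincat k) (M : monoidal C).

Definition tens_bilinear : Prop :=
  (forall (X X' Y Y' : C) (g : hom Y Y'),
     linear (fun f : hom X X' => tensm M f g)) /\
  (forall (X X' Y Y' : C) (f : hom X X'),
     linear (fun g : hom Y Y' => tensm M f g)).

(* X' is a left dual of X; equivalently, X is a right dual of X'. *)
Record left_dual (X' X : C) := LeftDual {
  dual_ev : hom (tens M X' X) (munit M);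
  dual_coev : hom (munit M) (tens M X X');
  dual_zigzag_left :
    mrunit M X \oc tensm M (idm X) dual_ev \oc massoc M X X' X
      \oc tensm M dual_coev (idm X) \oc isov (mlunit M X) = idm X;
  dual_zigzag_right :
    mlunit M X' \oc tensm M dual_ev (idm X') \oc isov (massoc M X' X X')
      \oc tensm M (idm X') dual_coev \oc isov (mrunit M X') = idm X'
}.

Record rigid := Rigid {
  ldual : C -> C;
  ldualP : forall X : C, left_dual (ldual X) X;
  rdual : C -> C;
  rdualP : forall X : C, left_dual X (rdual X)
}.

Section TensRight.
Variable V : C.
Fact tens_right1 (X : C) : tensm M (idm X) (idm V) = idm (tens M X V).
Proof. exact: tensm1. Qed.
Fact tens_rightM (X Y Z : C) (g : hom Y Z) (f : hom X Y) :
  tensm M (g \oc f) (idm V) = tensm M g (idm V) \oc tensm M f (idm V).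
Proof. by rewrite -tensmM comp1m. Qed.
(* The functor - (x) V. *)
Definition tens_right : functor C C :=
  @Functor k C C (fun X => tens M X V) (fun X Y f => tensm M f (idm V))
    tens_right1 tens_rightM.
End TensRight.

End Monoidal.

Record tensorCat (k : fieldType) := TensorCat {
  tc_cat :> lincat k;
  tc_abelian : abelian tc_cat;
  tc_monoidal :> monoidal tc_cat;
  tc_bilinear : tens_bilinear tc_monoidal;
  tc_rigid :> rigid tc_monoidal
}.

Record tensorFunctor (k : fieldType) (C D : tensorCat k) := TensorFunctor {
  tf_functor :> functor C D;
  tf_linear : linear_functor tf_functor;
  tf_mul : forall X Y : C,
    iso (tens D (tf_functor X) (tf_functor Y)) (tf_functor (tens C X Y));
  tf_unit : iso (munit D) (tf_functor (munit C));
  tf_mul_nat : forall (X X' Y Y' : C) (f : hom X X') (g : hom Y Y'),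
    tf_mul X' Y' \oc tensm D (fmap tf_functor f) (fmap tf_functor g) =
    fmap tf_functor (tensm C f g) \oc tf_mul X Y;
  tf_assoc : forall X Y Z : C,
    fmap tf_functor (massoc C X Y Z) \oc tf_mul (tens C X Y) Z
      \oc tensm D (tf_mul X Y) (idm (tf_functor Z)) =
    tf_mul X (tens C Y Z) \oc tensm D (idm (tf_functor X)) (tf_mul Y Z)
      \oc massoc D (tf_functor X) (tf_functor Y) (tf_functor Z);
  tf_lunit : forall X : C,
    fmap tf_functor (mlunit C X) \oc tf_mul (munit C) X
      \oc tensm D tf_unit (idm (tf_functor X)) = mlunit D (tf_functor X);
  tf_runit : forall X : C,
    fmap tf_functor (mrunit C X) \oc tf_mul X (munit C)
      \oc tensm D (idm (tf_functor X)) tf_unit = mrunit D (tf_functor X)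
}.

(* R is isomorphic to L(- (x) chi). *)
Definition is_relative_modular (k : fieldType) (C D : tensorCat k)
    (L R : functor D C) (chi : D) : Prop :=
  inhabited (natiso R (L \oF tens_right D chi)).

(* Main.v *)
From HB Require Import structures.
From mathcomp Require Import all_boot all_algebra.
From mathcomp Require Import boolp.
Require Import Defs.
From mathcomp Require Import ssralg.

(** The proof rests on two facts about L -| F -| R. First, the projection
    formula: L(F(A) (x) W) = A (x) L(W) and L(W (x) F(X)) = L(W) (x) X
    ([proj_map_iso], [rproj_map_iso]), because F preserves duals. Second, R is L
    conjugated by duality: if V is left dual to W, the projection formula and
    the counit of F -| R pair R(V) with L(W), and this pairing exhibits R(V) as
    left dual to L(W) ([dual_pairing_universal]).

    Thanks to these, an adjoint of L or R is determined by its value on the unit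
    object, that is, by a representation of Hom(1, L(-)) or of Hom(R(-), 1).

    - If 1 -> L(chi) represents Hom(1, L(-)), then
      R(V) = R(V) (x) 1 -> R(V) (x) L(chi) -> L(V (x) chi) is a natural
      isomorphism ([comparison_iso], [universal_relative_modular]). Conversely
      R = L(- (x) chi) has the right adjoint F(-) (x) chi^*
      ([relative_modular_couniversal]).
    - If R(gamma) -> 1 represents Hom(R(-), 1) and chi is the right dual of
      gamma, duality turns it into an arrow 1 -> L(chi) representing Hom(1, L(-))
      ([couniversal_universal]), and then X |-> F(X) (x) chi is left adjoint to
      L ([universal_unit_universal]).

    So the first three conditions are equivalent. Given R -| G, comparing G(1)
    with F(1) (x) chi^* gives chi = *G(1), whence uniqueness; given E -| L, the
    construction may be run with chi = E(1), whence E(1) = chi.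

    In the finite case, a functor with adjoints on both sides is exact. If L is
    exact it preserves monomorphisms, so R preserves epimorphisms by the duality
    above ([left_mono_right_epi]). By lifting along epimorphisms, R preserves
    epimorphisms if and only if F preserves projectives, since C has enough of
    them. Finally R, being a right adjoint, preserves kernels, so it is right
    exact once it preserves epimorphisms, and a right exact functor between
    finite categories has a right adjoint ([right_exact_has_right_adjoint]):
    Hom(R(-), X) is represented by a minimal quotient of a power P^d of a
    generator P through which a spanning family of d elements of Hom(R(P), X),
    seen as one element of Hom(R(P^d), X), factors. *)

Set Implicit Arguments.
Unset Strict Implicit.
Unset Printing Implicit Defensive.

Import GRing.Theory.
Local Open Scope ring_scope.
Local Open Scope cat_scope.

(** * Categories, adjoints and abelian categories *)

Lemma bij_cancel_r T U V (h : T -> U) (g : U -> V) :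
  bijective h -> bijective (fun x => g (h x)) -> bijective g.
Proof.
case=> h' hK h'K bgh.
apply: (eq_bij (bij_comp bgh (bij_can_bij (Bijective hK h'K) hK))).
by move=> y /=; rewrite h'K.
Qed.

Lemma bij_cancel_l T U V (h : T -> U) (g : U -> V) :
  bijective g -> bijective (fun x => g (h x)) -> bijective h.
Proof.
case=> g' gK g'K bgh.
apply: (eq_bij (bij_comp (bij_can_bij (Bijective gK g'K) gK) bgh)).
by move=> x /=; rewrite gK.
Qed.

Section Composition.
Variables (k : fieldType) (C : lincat k).
Implicit Types X Y Z W : C.

Lemma compDl X Y Z (f : hom X Y) (g h : hom Y Z) :
  (g + h) \oc f = g \oc f + h \oc f.
Proof. by have := comp_linearl f 1 g h; rewrite !scale1r. Qed.

Lemma compDr X Y Z (f g : hom X Y) (h : hom Y Z) :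
  h \oc (f + g) = h \oc f + h \oc g.
Proof. by have := comp_linearr h 1 f g; rewrite !scale1r. Qed.

Lemma comp0m X Y Z (f : hom X Y) : (0 : hom Y Z) \oc f = 0.
Proof. by apply: (addrI (0 \oc f)); rewrite -compDl !addr0. Qed.

Lemma compm0 X Y Z (g : hom Y Z) : g \oc (0 : hom X Y) = 0.
Proof. by apply: (addrI (g \oc 0)); rewrite -compDr !addr0. Qed.

Lemma compBl X Y Z (f : hom X Y) (g h : hom Y Z) :
  (g - h) \oc f = g \oc f - h \oc f.
Proof.
by apply/eqP; rewrite -subr_eq0 opprB addrA -compDl subrK subrr.
Qed.

Lemma compBr X Y Z (f g : hom X Y) (h : hom Y Z) :
  h \oc (f - g) = h \oc f - h \oc g.
Proof.
by apply/eqP; rewrite -subr_eq0 opprB addrA -compDr subrK subrr.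
Qed.

Lemma compZl X Y Z a (f : hom X Y) (g : hom Y Z) :
  (a *: g) \oc f = a *: (g \oc f).
Proof. by have := comp_linearl f a g 0; rewrite comp0m !addr0. Qed.

Lemma compZr X Y Z a (f : hom X Y) (g : hom Y Z) :
  g \oc (a *: f) = a *: (g \oc f).
Proof. by have := comp_linearr g a f 0; rewrite compm0 !addr0. Qed.

Lemma comp_suml X Y Z I (r : seq I) (f : hom X Y) (g : I -> hom Y Z) :
  (\sum_(i <- r) g i) \oc f = \sum_(i <- r) g i \oc f.
Proof.
by apply: (big_morph (fun x => x \oc f)) => [x y|]; rewrite ?compDl ?comp0m.
Qed.

Lemma comp_sumr X Y Z I (r : seq I) (g : I -> hom X Y) (f : hom Y Z) :
  f \oc (\sum_(i <- r) g i) = \sum_(i <- r) f \oc g i.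
Proof.
by apply: (big_morph (fun x => f \oc x)) => [x y|]; rewrite ?compDr ?compm0.
Qed.

(** For rewriting with an equation between composites inside a longer
    left-associated composite; [mid3] is the variant for three factors. *)
Lemma mid X Y Z (a : hom Y Z) (b : hom X Y) (c : hom X Z) :
  a \oc b = c -> forall W (x : hom Z W), x \oc a \oc b = x \oc c.
Proof. by move=> <- W x; rewrite compA. Qed.

Lemma mid3 X Y Z U (a : hom Z U) (b : hom Y Z) (c : hom X Y) (d : hom X U) :
  a \oc b \oc c = d ->
  forall W (x : hom U W), x \oc a \oc b \oc c = x \oc d.
Proof. by move=> <- W x; rewrite !compA. Qed.

Definition iso_inv X Y (i : iso X Y) : iso Y X := Iso (isovK i) (isofK i).

Lemma iso_comp_subproof X Y Z (j : iso Y Z) (i : iso X Y) :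
  (isov i \oc isov j) \oc (j \oc i) = idm X /\
  (j \oc i) \oc (isov i \oc isov j) = idm Z.
Proof.
by rewrite !compA (mid (isofK j)) (mid (isovK i)) !compm1 isofK isovK.
Qed.

Definition iso_comp X Y Z (j : iso Y Z) (i : iso X Y) : iso X Z :=
  Iso (proj1 (iso_comp_subproof j i)) (proj2 (iso_comp_subproof j i)).

Lemma isomorphic_sym X Y : isomorphic X Y -> isomorphic Y X.
Proof. by case=> i; exists; apply: iso_inv. Qed.

Lemma isomorphic_trans Y X Z :
  isomorphic X Y -> isomorphic Y Z -> isomorphic X Z.
Proof. by case=> i [j]; exists; apply: iso_comp j i. Qed.

Lemma iso_epi X Y (i : iso X Y) : epi i.
Proof.
by move=> W g h e; rewrite -(compm1 g) -(compm1 h) -(isovK i) !compA e.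
Qed.

Lemma isov_epi X Y (i : iso X Y) : epi (isov i).
Proof. exact: (@iso_epi _ _ (iso_inv i)). Qed.

Lemma iso_mono X Y (i : iso X Y) : mono i.
Proof.
by move=> W g h e; rewrite -(comp1m g) -(comp1m h) -(isofK i) -!compA e.
Qed.

Lemma precomp_iso_bij X Y (i : iso X Y) Z :
  bijective (fun f : hom Y Z => f \oc i).
Proof.
exists (fun f => f \oc isov i) => f.
  by rewrite -compA isovK compm1.
by rewrite -compA isofK compm1.
Qed.

Lemma postcomp_iso_bij X Y (i : iso X Y) Z :
  bijective (fun f : hom Z X => i \oc f).
Proof.
exists (fun f => isov i \oc f) => f.
  by rewrite compA isofK comp1m.
by rewrite compA isovK comp1m.
Qed.

(** The Yoneda lemma, in the form used to recognize isomorphisms. *)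
Lemma precomp_bij_iso X Y (f : hom X Y) :
  (forall Z, bijective (fun g : hom Y Z => g \oc f)) ->
  exists i : iso X Y, isof i = f.
Proof.
move=> bij; have [h hK Kh] := bij X.
have e1 : h (idm X) \oc f = idm X by apply: Kh.
have e2 : f \oc h (idm X) = idm Y.
  by apply: (bij_inj (bij Y)); rewrite /= -compA e1 compm1 comp1m.
by exists (Iso e1 e2).
Qed.

Lemma epiP X Y (f : hom X Y) :
  (forall Z (g : hom Y Z), g \oc f = 0 -> g = 0) -> epi f.
Proof.
move=> f0 Z g h e; apply/eqP; rewrite -subr_eq0; apply/eqP/f0.
by rewrite compBl e subrr.
Qed.

Lemma monoP X Y (f : hom X Y) :
  (forall Z (g : hom Z X), f \oc g = 0 -> g = 0) -> mono f.
Proof.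
move=> f0 Z g h e; apply/eqP; rewrite -subr_eq0; apply/eqP/f0.
by rewrite compBr e subrr.
Qed.

Lemma epi_comp X Y Z (g : hom Y Z) (f : hom X Y) :
  epi g -> epi f -> epi (g \oc f).
Proof. by move=> eg ef W a b; rewrite !compA => /ef/eg. Qed.

Lemma epi_compl X Y Z (g : hom Y Z) (f : hom X Y) : epi (g \oc f) -> epi g.
Proof. by move=> e W a b h; apply: e; rewrite !compA h. Qed.

Lemma kernel_mono X Y K (f : hom X Y) (i : hom K X) : is_kernel f i -> mono i.
Proof.
case=> fi univ; apply: monoP => Z g ig.
have [h [_ uh]] := univ Z 0 (compm0 _ f).
by rewrite -(uh g ig) (uh 0) // compm0.
Qed.

Lemma cokernel_epi X Y Q (f : hom X Y) (p : hom Y Q) :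
  is_cokernel f p -> epi p.
Proof.
case=> pf univ; apply: epiP => Z g gp.
have [h [_ uh]] := univ Z 0 (comp0m _ f).
by rewrite -(uh g gp) (uh 0) // comp0m.
Qed.

End Composition.

Section Abelian.
Variables (k : fieldType) (C : lincat k) (abC : abelian C).
Implicit Types X Y Z W : C.

Lemma mono_kernel_of_cokernel X Y Q (f : hom X Y) (p : hom Y Q) :
  mono f -> is_cokernel f p -> is_kernel p f.
Proof.
move=> mf [pf univp]; split=> // W g pg.
have [Z [q [qf univq]]] := ab_mono abC mf.
have [q' [qE _]] := univp Z q qf.
by apply: univq; rewrite -qE -compA pg compm0.
Qed.

Lemma epi_cokernel_of_kernel X Y K (g : hom X Y) (i : hom K X) :
  epi g -> is_kernel g i -> is_cokernel i g.
Proof.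
move=> eg [gi univi]; split=> // W h hi.
have [Z [q [gq univq]]] := ab_epi abC eg.
have [q' [qE _]] := univi Z q gq.
by apply: univq; rewrite -qE compA hi comp0m.
Qed.

Lemma mono_epi_iso X Y (f : hom X Y) :
  mono f -> epi f -> exists i : iso X Y, isof i = f.
Proof.
move=> mf ef; have [Z [g [gf univ]]] := ab_mono abC mf.
have g0 : g = 0 by apply: ef; rewrite gf comp0m.
have [h [fh _]] : exists! h : hom Y X, f \oc h = idm Y.
  by apply: univ; rewrite compm1.
have hf : h \oc f = idm X by apply: mf; rewrite compA fh comp1m compm1.
by exists (Iso hf fh).
Qed.

(** The corestriction of a morphism to its image, the kernel of its cokernel,
    is epi: a morphism killing e has as kernel a subobject of the image through
    which f factors, and the image is the least such subobject of Y. *)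
Lemma image_epi X Y Q I (f : hom X Y) (c : hom Y Q) (i : hom I Y)
    (e : hom X I) :
  is_cokernel f c -> is_kernel c i -> i \oc e = f -> epi e.
Proof.
move=> [cf univc] keri ie; apply: epiP => T t te.
have mi := kernel_mono keri.
have [J [j kerj]] := ab_ker abC t.
have [e' [je' _]] := proj2 kerj _ e te.
have mij : mono (i \oc j).
  by move=> W g h; rewrite -!compA => /mi/(kernel_mono kerj).
have [Z [q cokq]] := ab_coker abC (i \oc j).
have kerq := mono_kernel_of_cokernel mij cokq.
have qf : q \oc f = 0 by rewrite -ie -je' !compA -(compA q) (proj1 cokq) comp0m.
have [q' [qE _]] := univc _ q qf.
have qi : q \oc i = 0 by rewrite -qE -compA (proj1 keri) compm0.
have [s [ijs _]] := proj2 kerq _ i qi.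
have js : j \oc s = idm I by apply: mi; rewrite compA ijs compm1.
by rewrite -(compm1 t) -js compA (proj1 kerj) comp0m.
Qed.

Lemma power_object X n :
  exists P (inj : 'I_n -> hom X P) (prj : 'I_n -> hom P X),
  [/\ forall i, prj i \oc inj i = idm X,
      forall i j, i != j -> prj i \oc inj j = 0 &
      \sum_i inj i \oc prj i = idm P].
Proof.
elim: n => [|n [P [inj [prj [prjinj prjinj0 sum1]]]]].
  have [Z Z0] := ab_zero abC.
  exists Z, (fun=> 0), (fun=> 0); split=> [[]//|[]//|].
  by rewrite big_ord0; apply/esym; case: (Z0 Z) => h _; apply: h.
have [Q [i1 [i2 [p1 [p2 [p1i1 p2i2 p1i2 p2i1 sumQ]]]]]] := ab_biprod abC X P.
exists Q.
exists (fun i => if unlift ord0 i is Some j then i2 \oc inj j else i1).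
exists (fun i => if unlift ord0 i is Some j then prj j \oc p2 else p1).
have p2i2' W (x : hom P W) : x \oc p2 \oc i2 = x by rewrite -compA p2i2 compm1.
split=> [i|i j|].
- by case: unliftP => [j|] _ //; rewrite compA p2i2'.
- case: unliftP => [a|] ->; case: unliftP => [b|] -> //.
  + rewrite (inj_eq lift_inj) => ab.
    by rewrite compA p2i2' prjinj0.
  + by move=> _; rewrite -compA p2i1 compm0.
  + by move=> _; rewrite compA p1i2 comp0m.
rewrite big_ord_recl unlift_none -[RHS]sumQ; congr (_ + _).
under eq_bigr => i _ do rewrite liftK compA -(compA i2).
by rewrite -comp_suml -comp_sumr sum1 compm1.
Qed.

End Abelian.

Lemma projective_power (k : fieldType) (C : lincat k) (P Q : C) n
    (inj : 'I_n -> hom P Q) (prj : 'I_n -> hom Q P) :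
  \sum_i inj i \oc prj i = idm Q -> projective P -> projective Q.
Proof.
move=> sum1 projP X Y g f eg.
have [h hE] := choice (fun i => projP X Y g (f \oc inj i) eg).
exists (\sum_i h i \oc prj i).
rewrite comp_sumr -[RHS]compm1 -sum1 comp_sumr.
by apply: eq_bigr => i _; rewrite compA hE compA.
Qed.

Section Functors.
Variables (k : fieldType) (C D : lincat k).

Lemma additive0 (F : functor C D) (addF : additive_functor F) X Y :
  fmap F (0 : hom X Y) = 0.
Proof.
by apply: (addrI (fmap F (0 : hom X Y))); rewrite -addF !addr0.
Qed.

Lemma additiveB (F : functor C D) (addF : additive_functor F) X Y
  (f g : hom X Y) : fmap F (f - g) = fmap F f - fmap F g.
Proof.
by apply/eqP; rewrite -subr_eq0 opprB addrA -addF subrK subrr.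
Qed.

Lemma linear_additive (F : functor C D) :
  linear_functor F -> additive_functor F.
Proof. by move=> linF X Y f g; have := linF X Y 1 f g; rewrite !scale1r. Qed.

Definition fmap_iso (F : functor C D) X Y (i : iso X Y) : iso (F X) (F Y) :=
  @Iso _ _ _ _ (fmap F i) (fmap F (isov i))
    (etrans (esym (fmapM F _ _)) (etrans (congr1 _ (isofK i)) (fmap1 F _)))
    (etrans (esym (fmapM F _ _)) (etrans (congr1 _ (isovK i)) (fmap1 F _))).

End Functors.

Section Universal.
Variables (k : fieldType) (C D : lincat k).

(** That (G0, e) represents the functor Hom(R(-), X); an adjoint of R is handled
    one object at a time through such representations. *)
Definition couniversal (R : functor D C) (X : C) (G0 : D) (e : hom (R G0) X) :=
  forall V, bijective (fun h : hom V G0 => e \oc fmap R h).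

Definition universal (L : functor D C) (X : C) (E0 : D) (n : hom X (L E0)) :=
  forall W, bijective (fun h : hom E0 W => fmap L h \oc n).

Lemma adj_couniversal (R : functor D C) (G : functor C D)
  (adj : adjunction R G) X : couniversal (adj_counit adj X).
Proof.
move=> V; exists (fun f => fmap G f \oc adj_unit adj V) => [h|f].
  rewrite fmapM -compA -adj_unit_nat compA.
  by rewrite adj_triangle_right comp1m.
rewrite fmapM compA adj_counit_nat -compA.
by rewrite adj_triangle_left compm1.
Qed.

Lemma adj_universal (L : functor D C) (E : functor C D)
  (adj : adjunction E L) X : universal (adj_unit adj X).
Proof.
move=> W; exists (fun f => adj_counit adj W \oc fmap E f) => [h|f].
  rewrite fmapM compA adj_counit_nat -compA.
  by rewrite adj_triangle_left compm1.
rewrite fmapM -compA -adj_unit_nat compA.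
by rewrite adj_triangle_right comp1m.
Qed.

(** An adjoint is given by a choice of universal arrows; functoriality and the
    triangle identities come from the uniqueness of factorizations. *)
Lemma couniversal_right_adjoint (R : functor D C) :
  (forall X, exists G0 (e : hom (R G0) X), couniversal e) ->
  has_right_adjoint R.
Proof.
move=> univ; pose G0 X := sval (cid (univ X)).
pose e X : hom (R (G0 X)) X := sval (cid (svalP (cid (univ X)))).
have bij X : couniversal (e X) := svalP (cid (svalP (cid (univ X)))).
have lift X V (f : hom (R V) X) : {h : hom V (G0 X) | e X \oc fmap R h = f}.
  by apply: cid; have [g _ gK] := bij X V; exists (g f); apply: gK.
have inj X V (h h' : hom V (G0 X)) :
    e X \oc fmap R h = e X \oc fmap R h' -> h = h'.
  exact: (bij_inj (bij X V)).
pose fm X Y (f : hom X Y) : hom (G0 X) (G0 Y) := sval (lift _ _ (f \oc e X)).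
have fmE X Y (f : hom X Y) : e Y \oc fmap R (fm X Y f) = f \oc e X.
  exact: (svalP (lift _ _ (f \oc e X))).
have fm1 X : fm X X (idm X) = idm (G0 X).
  by apply: inj; rewrite fmE fmap1 comp1m compm1.
have fmM X Y Z (g : hom Y Z) (f : hom X Y) :
    fm X Z (g \oc f) = fm Y Z g \oc fm X Y f.
  by apply: inj; rewrite fmE fmapM !compA fmE -!compA fmE.
pose u V : hom V (G0 (R V)) := sval (lift _ _ (idm (R V))).
have uE V : e (R V) \oc fmap R (u V) = idm (R V).
  exact: (svalP (lift _ _ (idm (R V)))).
exists (@Functor _ _ _ G0 fm fm1 fmM); exists.
apply: (@Adjunction _ _ _ R (@Functor _ _ _ G0 fm fm1 fmM) u e) => /=.
- move=> V V' h; apply: inj; rewrite !fmapM !compA fmE uE -compA uE.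
  by rewrite comp1m compm1.
- exact: fmE.
- exact: uE.
- by move=> X; apply: inj; rewrite fmapM compA fmE -compA uE fmap1.
Qed.

Lemma universal_left_adjoint (L : functor D C) :
  (forall X, exists E0 (n : hom X (L E0)), universal n) ->
  has_left_adjoint L.
Proof.
move=> univ; pose E0 X := sval (cid (univ X)).
pose n X : hom X (L (E0 X)) := sval (cid (svalP (cid (univ X)))).
have bij X : universal (n X) := svalP (cid (svalP (cid (univ X)))).
have lift X W (f : hom X (L W)) : {h : hom (E0 X) W | fmap L h \oc n X = f}.
  by apply: cid; have [g _ gK] := bij X W; exists (g f); apply: gK.
have inj X W (h h' : hom (E0 X) W) :
    fmap L h \oc n X = fmap L h' \oc n X -> h = h'.
  exact: (bij_inj (bij X W)).
pose fm X Y (f : hom X Y) : hom (E0 X) (E0 Y) := sval (lift _ _ (n Y \oc f)).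
have fmE X Y (f : hom X Y) : fmap L (fm X Y f) \oc n X = n Y \oc f.
  exact: (svalP (lift _ _ (n Y \oc f))).
have fm1 X : fm X X (idm X) = idm (E0 X).
  by apply: inj; rewrite fmE fmap1 comp1m compm1.
have fmM X Y Z (g : hom Y Z) (f : hom X Y) :
    fm X Z (g \oc f) = fm Y Z g \oc fm X Y f.
  by apply: inj; rewrite fmE fmapM -!compA fmE !compA fmE.
pose c W : hom (E0 (L W)) W := sval (lift _ _ (idm (L W))).
have cE W : fmap L (c W) \oc n (L W) = idm (L W).
  exact: (svalP (lift _ _ (idm (L W)))).
exists (@Functor _ _ _ E0 fm fm1 fmM); exists.
apply: (@Adjunction _ _ _ (@Functor _ _ _ E0 fm fm1 fmM) L n c) => /=.
- by move=> X X' f; rewrite fmE.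
- move=> W W' h; apply: inj; rewrite !fmapM -!compA fmE cE compA cE.
  by rewrite comp1m compm1.
- by move=> X; apply: inj; rewrite fmapM -compA fmE compA cE fmap1.
- exact: cE.
Qed.

Lemma couniversal_unique (R : functor D C) X G0 G1
    (e0 : hom (R G0) X) (e1 : hom (R G1) X) :
  couniversal e0 -> couniversal e1 -> isomorphic G0 G1.
Proof.
move=> u0 u1.
have [[f _ fK] [g _ gK]] := (u0 G1, u1 G0).
have E0 := fK e1; have E1 := gK e0; rewrite /= in E0 E1.
have e01 : f e1 \oc g e0 = idm G0.
  by apply: (bij_inj (u0 _)); rewrite fmapM compA E0 E1 fmap1 compm1.
have e10 : g e0 \oc f e1 = idm G1.
  by apply: (bij_inj (u1 _)); rewrite fmapM compA E1 E0 fmap1 compm1.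
by exists; exact: (Iso e01 e10).
Qed.

End Universal.

Section AdjointExactness.
Variables (k : fieldType) (C D : lincat k).
Variables (P : functor C D) (Q : functor D C) (adj : adjunction P Q).

Lemma left_adjoint_linear : linear_functor Q -> linear_functor P.
Proof.
move=> linQ X Y a f g; apply: (bij_inj (adj_universal adj X _)).
by rewrite /= linQ !compDl !compZl -!adj_unit_nat compDr compZr.
Qed.

Lemma right_adjoint_linear : linear_functor P -> linear_functor Q.
Proof.
move=> linP X Y a f g; apply: (bij_inj (adj_couniversal adj Y _)).
by rewrite /= linP !compDr !compZr !adj_counit_nat compDl compZl.
Qed.

Hypotheses (addP : additive_functor P) (addQ : additive_functor Q).

Lemma right_adjoint_kernel X Y K (f : hom X Y) (i : hom K X) :
  is_kernel f i -> is_kernel (fmap Q f) (fmap Q i).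
Proof.
move=> keri; have [fi univ] := keri.
split=> [|W g fg]; first by rewrite -fmapM fi additive0.
have [|h [hE _]] := univ _ (adj_counit adj X \oc fmap P g).
  by rewrite compA -adj_counit_nat -compA -fmapM fg additive0 // compm0.
have [t _ tK] := adj_couniversal adj K W.
exists (t h); split=> [|h' h'E].
  apply: (bij_inj (adj_couniversal adj _ _)).
  by rewrite /= fmapM compA adj_counit_nat -compA tK.
apply: (bij_inj (adj_couniversal adj _ _)); rewrite tK.
apply: (kernel_mono keri); rewrite hE -h'E compA.
by rewrite fmapM compA adj_counit_nat.
Qed.

Lemma left_adjoint_cokernel X Y Z (f : hom X Y) (p : hom Y Z) :
  is_cokernel f p -> is_cokernel (fmap P f) (fmap P p).
Proof.
move=> cokp; have [pf univ] := cokp.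
split=> [|W g gf]; first by rewrite -fmapM pf additive0.
have [|h [hE _]] := univ _ (fmap Q g \oc adj_unit adj Y).
  by rewrite -compA adj_unit_nat compA -fmapM gf additive0 // comp0m.
have [t _ tK] := adj_universal adj Z W.
exists (t h); split=> [|h' h'E].
  apply: (bij_inj (adj_universal adj _ _)).
  by rewrite /= fmapM -compA -adj_unit_nat compA tK.
apply: (bij_inj (adj_universal adj _ _)); rewrite tK.
apply: (cokernel_epi cokp); rewrite hE -h'E -compA.
by rewrite fmapM -compA -adj_unit_nat.
Qed.

End AdjointExactness.

(** * Duality in monoidal categories *)

Section Monoidal.
Variables (k : fieldType) (C : lincat k) (M : monoidal C).
Implicit Types X Y Z W A B : C.

Local Notation "X ** Y" := (tens M X Y) (at level 35).
Local Notation "f ## g" := (tensm M f g) (at level 35).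
Local Notation "1" := (munit M).
Local Notation asc := (massoc M).

Lemma tensm_compl X Y Z W (g : hom Y Z) (f : hom X Y) :
  (g \oc f) ## idm W = g ## idm W \oc f ## idm W.
Proof. by rewrite -tensmM comp1m. Qed.

Lemma tensm_compr X Y Z W (g : hom Y Z) (f : hom X Y) :
  idm W ## (g \oc f) = idm W ## g \oc idm W ## f.
Proof. by rewrite -tensmM comp1m. Qed.

Lemma tensm_lr X X' Y Y' (f : hom X X') (g : hom Y Y') :
  f ## idm Y' \oc idm X ## g = f ## g.
Proof. by rewrite -tensmM comp1m compm1. Qed.

Lemma tensm_rl X X' Y Y' (f : hom X X') (g : hom Y Y') :
  idm X' ## g \oc f ## idm Y = f ## g.
Proof. by rewrite -tensmM comp1m compm1. Qed.

Lemma tensm_swap X X' Y Y' (f : hom X X') (g : hom Y Y') :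
  idm X' ## g \oc f ## idm Y = f ## idm Y' \oc idm X ## g.
Proof. by rewrite tensm_rl tensm_lr. Qed.

Lemma tensl_isofK X Y W (i : iso X Y) : isov i ## idm W \oc i ## idm W = idm _.
Proof. by rewrite -tensm_compl isofK tensm1. Qed.

Lemma tensl_isovK X Y W (i : iso X Y) : i ## idm W \oc isov i ## idm W = idm _.
Proof. by rewrite -tensm_compl isovK tensm1. Qed.

Lemma tensr_isofK X Y W (i : iso X Y) : idm W ## isov i \oc idm W ## i = idm _.
Proof. by rewrite -tensm_compr isofK tensm1. Qed.

Lemma tensr_isovK X Y W (i : iso X Y) : idm W ## i \oc idm W ## isov i = idm _.
Proof. by rewrite -tensm_compr isovK tensm1. Qed.

Lemma massoc_natl X X' Y Z (f : hom X X') :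
  asc X' Y Z \oc (f ## idm Y) ## idm Z = f ## idm (Y ** Z) \oc asc X Y Z.
Proof. by rewrite massoc_nat tensm1. Qed.

Lemma massoc_natr X Y Z Z' (h : hom Z Z') :
  asc X Y Z' \oc idm (X ** Y) ## h = idm X ## (idm Y ## h) \oc asc X Y Z.
Proof. by rewrite -massoc_nat tensm1. Qed.

Lemma massocV_nat X X' Y Y' Z Z' (f : hom X X') (g : hom Y Y') (h : hom Z Z') :
  isov (asc X' Y' Z') \oc f ## (g ## h) =
  (f ## g) ## h \oc isov (asc X Y Z).
Proof.
apply: (@iso_epi _ _ _ _ (asc X Y Z)).
by rewrite -!compA isofK -massoc_nat compA isofK comp1m compm1.
Qed.

Lemma massocV_natl X X' Y Z (f : hom X X') :
  isov (asc X' Y Z) \oc f ## idm (Y ** Z) =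
  (f ## idm Y) ## idm Z \oc isov (asc X Y Z).
Proof. by rewrite -tensm1 massocV_nat. Qed.

Lemma massocV_natr X Y Z Z' (h : hom Z Z') :
  isov (asc X Y Z') \oc idm X ## (idm Y ## h) =
  idm (X ** Y) ## h \oc isov (asc X Y Z).
Proof. by rewrite massocV_nat tensm1. Qed.

Lemma mlunitV_nat X X' (f : hom X X') :
  isov (mlunit M X') \oc f = idm 1 ## f \oc isov (mlunit M X).
Proof.
apply: (@iso_epi _ _ _ _ (mlunit M X)).
by rewrite -!compA isofK -mlunit_nat compA isofK comp1m compm1.
Qed.

Lemma mrunitV_nat X X' (f : hom X X') :
  isov (mrunit M X') \oc f = f ## idm 1 \oc isov (mrunit M X).
Proof.
apply: (@iso_epi _ _ _ _ (mrunit M X)).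
by rewrite -!compA isofK -mrunit_nat compA isofK comp1m compm1.
Qed.

Lemma mpentagonV W X Y Z :
  isov (asc (W ** X) Y Z) \oc isov (asc W X (Y ** Z)) =
  isov (asc W X Y) ## idm Z \oc isov (asc W (X ** Y) Z)
    \oc idm W ## isov (asc X Y Z).
Proof.
apply: (@iso_epi _ _ _ _
  (iso_comp (asc W X (Y ** Z)) (asc (W ** X) Y Z))) => /=.
rewrite [LHS]compA (mid (isofK _)) compm1 isofK mpentagon !compA.
by rewrite (mid (tensr_isofK _ _)) compm1 (mid (isofK _)) compm1 tensl_isofK.
Qed.

Lemma mpentagon_mid W X Y Z :
  isov (asc W X (Y ** Z)) \oc idm W ## asc X Y Z =
  asc (W ** X) Y Z \oc isov (asc W X Y) ## idm Z \oc isov (asc W (X ** Y) Z).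
Proof.
apply: (@iso_epi _ _ _ _ (iso_comp (asc W (X ** Y) Z)
  (fmap_iso (tens_right M Z) (asc W X Y)))).
rewrite /= !compA (mid (isofK _)) compm1 (mid (tensl_isofK _ _)) compm1.
rewrite -(compA _ _ (asc W (X ** Y) Z)) -compA -mpentagon compA isofK.
by rewrite comp1m.
Qed.

Lemma mpentagonV_mid W X Y Z :
  idm W ## isov (asc X Y Z) \oc asc W X (Y ** Z) =
  asc W (X ** Y) Z \oc asc W X Y ## idm Z \oc isov (asc (W ** X) Y Z).
Proof.
apply: (@iso_epi _ _ _ _ (asc (W ** X) Y Z)).
rewrite (mid (isofK _)) compm1 -compA mpentagon !compA tensr_isofK.
by rewrite comp1m.
Qed.

Lemma mtriangleVV X Y :
  isov (asc X 1 Y) \oc idm X ## isov (mlunit M Y) =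
  isov (mrunit M X) ## idm Y.
Proof.
apply: (@iso_epi _ _ _ _ (fmap_iso (tens_right M Y) (mrunit M X))) => /=.
rewrite tensl_isofK -mtriangle compA (mid (tensr_isofK _ _)) compm1.
exact: isofK.
Qed.

Lemma mtriangleV X Y :
  mrunit M X ## idm Y \oc isov (asc X 1 Y) = idm X ## mlunit M Y.
Proof. by rewrite -mtriangle -compA isovK compm1. Qed.

Lemma munit_tensm_inj X Y (f g : hom X Y) :
  idm 1 ## f = idm 1 ## g -> f = g.
Proof.
by move=> e; apply: (@iso_epi _ _ _ _ (mlunit M X)); rewrite -!mlunit_nat e.
Qed.

(** Kelly's lemma: both sides agree after tensoring on the left by the unit,
    which is faithful, by the pentagon on 1, 1, X, Y and the triangles. *)
Lemma mlunit_tens X Y :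
  mlunit M (X ** Y) \oc asc 1 X Y = mlunit M X ## idm Y.
Proof.
apply: munit_tensm_inj; rewrite tensm_compr.
pose i := iso_comp (asc 1 (1 ** X) Y)
  (fmap_iso (tens_right M Y) (asc 1 1 X)).
apply: (@iso_epi _ _ _ _ i); rewrite /= !compA.
rewrite -(compA _ _ (asc 1 (1 ** X) Y)) -compA -mpentagon compA mtriangle.
rewrite -tensm1 -massoc_nat.
by rewrite -massoc_nat -!compA -tensmM mtriangle comp1m.
Qed.

Lemma mlunit_tensV X Y :
  isov (asc 1 X Y) \oc isov (mlunit M (X ** Y)) = isov (mlunit M X) ## idm Y.
Proof.
apply: (@iso_epi _ _ _ _ (fmap_iso (tens_right M Y) (mlunit M X))) => /=.
by rewrite tensl_isofK -mlunit_tens compA (mid (isofK _)) compm1 isofK.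
Qed.

Fact rev_pentagon W X Y Z :
  isov (asc (tens M Z Y) X W) \oc isov (asc Z Y (X ** W)) =
  isov (asc Z Y X) ## idm W \oc isov (asc Z (Y ** X) W)
    \oc idm Z ## isov (asc Y X W).
Proof. exact: mpentagonV. Qed.

(** The reversed tensor product makes the right-handed statements below instances
    of left-handed ones. *)
Definition rev_monoidal : monoidal C :=
  @Monoidal k C (fun X Y => Y ** X) (fun _ _ _ _ f g => g ## f)
    (fun X Y => tensm1 M Y X)
    (fun _ _ _ _ _ _ f' f g' g => tensmM M g' g f' f)
    1 (fun X Y Z => iso_inv (asc Z Y X)) (mrunit M) (mlunit M)
    (fun _ _ _ _ _ _ f g h => massocV_nat h g f)
    (@mrunit_nat _ _ M) (@mlunit_nat _ _ M) rev_pentagon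
    (fun X Y => mtriangleV Y X).

Definition rev_dual X' X (d : left_dual M X' X) : left_dual rev_monoidal X X' :=
  @LeftDual _ _ rev_monoidal X X' (dual_ev d) (dual_coev d)
    (dual_zigzag_right d) (dual_zigzag_left d).

(** The mate of u under the duality between X' and X, written with the
    evaluation alone so that it makes sense for an arbitrary pairing. *)
Definition lcontract X' X (ev : hom (X' ** X) 1) A B (u : hom A (X ** B)) :
    hom (X' ** A) B :=
  mlunit M B \oc ev ## idm B \oc isov (asc X' X B) \oc idm X' ## u.

Lemma lcontract_natl X' X (ev : hom (X' ** X) 1) A A' B
    (u : hom A (X ** B)) (f : hom A' A) :
  lcontract ev (u \oc f) = lcontract ev u \oc idm X' ## f.
Proof. by rewrite /lcontract tensm_compr !compA. Qed.

Lemma lcontract_natr X' X (ev : hom (X' ** X) 1) A B B'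
    (u : hom A (X ** B)) (g : hom B B') :
  lcontract ev (idm X ## g \oc u) = g \oc lcontract ev u.
Proof.
rewrite /lcontract tensm_compr !compA (mid (massocV_natr _ _ _)) compA.
by rewrite (mid (esym (tensm_swap _ _))) compA mlunit_nat.
Qed.

(** Dinaturality: for morphisms f and f' adjoint to each other with respect to the
    two pairings, contraction can be moved from one pairing to the other. *)
Lemma lcontract_dinat X' X Y' Y (evX : hom (X' ** X) 1) (evY : hom (Y' ** Y) 1)
    (f : hom X Y) (f' : hom Y' X') A B (u : hom A (X ** B)) :
  evY \oc idm Y' ## f = evX \oc f' ## idm X ->
  lcontract evY (f ## idm B \oc u) = lcontract evX u \oc f' ## idm A.
Proof.
move=> e; rewrite /lcontract tensm_compr !compA (mid (massocV_nat _ _ _)).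
have eB := congr1 (fun h => h ## idm B) e; rewrite !tensm_compl in eB.
rewrite !compA (mid eB) compA (mid (esym (massocV_natl _ _ _))) compA.
by rewrite (mid (tensm_lr _ _)) (mid (tensm_rl _ _)).
Qed.

Section Dual.
Variables (X' X : C) (d : left_dual M X' X).
Local Notation ev := (dual_ev d).
Local Notation coev := (dual_coev d).

Let lexpand A B (v : hom (X' ** A) B) : hom A (X ** B) :=
  idm X ## v \oc asc X X' A \oc coev ## idm A \oc isov (mlunit M A).

(** The two composites are the zigzags tensored on the right by an object, up to
    the pentagon and Kelly's lemma. *)
Lemma lcontract_bij A B : bijective (@lcontract X' X ev A B).
Proof.
exists (@lexpand A B) => [u|v].
  transitivity (lexpand (lcontract ev (idm (X ** B))) \oc u).
    rewrite -[in LHS](comp1m u) lcontract_natl /lexpand tensm_compr -!compA.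
    rewrite mlunitV_nat !compA (mid (tensm_lr _ _)).
    rewrite (mid (esym (massoc_natr _ _ _))).
    by rewrite compA (mid (tensm_rl _ _)).
  rewrite -[RHS]comp1m; congr (_ \oc _).
  rewrite /lexpand /lcontract tensm1 compm1 !tensm_compr.
  rewrite (mid (mpentagonV_mid _ _ _ _)) !compA.
  rewrite (mid (esym (massoc_nat M _ _ _))) compA mtriangle.
  rewrite (mid (massocV_natl _ _ _)) compA (mid (mlunit_tensV _ _)).
  by rewrite -!tensm_compl dual_zigzag_left tensm1.
rewrite /lexpand -!(compA (idm X ## v)) lcontract_natr -[RHS]compm1.
congr (_ \oc _).
rewrite /lcontract !tensm_compr !compA.
rewrite (mid (mpentagon_mid _ _ _ _)) !compA (mid (massocV_nat _ _ _)) compA.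
rewrite (mid (mtriangleVV _ _)) (mid (esym (massoc_natl _ _ _))) compA.
rewrite mlunit_tens -!tensm_compl.
by rewrite dual_zigzag_right tensm1.
Qed.

End Dual.

End Monoidal.

Section RightHanded.
Variables (k : fieldType) (C : lincat k) (M : monoidal C).
Implicit Types X Y Z W A B : C.

Local Notation "X ** Y" := (tens M X Y) (at level 35).
Local Notation "f ## g" := (tensm M f g) (at level 35).
Local Notation "1" := (munit M).
Local Notation asc := (massoc M).
Local Notation rev := (rev_monoidal M).

Lemma mrunit_tensV X Y :
  asc X Y 1 \oc isov (mrunit M (X ** Y)) = idm X ## isov (mrunit M Y).
Proof. exact: (mlunit_tensV rev Y X). Qed.

Definition rcontract X' X (ev : hom (X' ** X) 1) A B (u : hom A (B ** X')) :
    hom (A ** X) B :=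
  mrunit M B \oc idm B ## ev \oc asc B X' X \oc u ## idm X.

Lemma rcontract_natl X' X (ev : hom (X' ** X) 1) A A' B
    (u : hom A (B ** X')) (f : hom A' A) :
  rcontract ev (u \oc f) = rcontract ev u \oc f ## idm X.
Proof. exact: (@lcontract_natl _ _ rev X X' ev A A' B u f). Qed.

Lemma rcontract_natr X' X (ev : hom (X' ** X) 1) A B B'
    (u : hom A (B ** X')) (g : hom B B') :
  rcontract ev (g ## idm X' \oc u) = g \oc rcontract ev u.
Proof. exact: (@lcontract_natr _ _ rev X X' ev A B B' u g). Qed.

Lemma rcontract_bij X' X (d : left_dual M X' X) A B :
  bijective (@rcontract X' X (dual_ev d) A B).
Proof. exact: (@lcontract_bij _ _ rev X X' (rev_dual d) A B). Qed.

End RightHanded.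

Section Evaluation.
Variables (k : fieldType) (C : lincat k) (M : monoidal C).
Implicit Types X Y Z W A B : C.

Local Notation "X ** Y" := (tens M X Y) (at level 35).
Local Notation "f ## g" := (tensm M f g) (at level 35).
Local Notation "1" := (munit M).
Local Notation asc := (massoc M).

Lemma lcontract_unit X' X (ev : hom (X' ** X) 1) A (u : hom A X) :
  lcontract ev (isov (mrunit M X) \oc u) =
  mlunit M 1 \oc isov (mrunit M 1) \oc (ev \oc idm X' ## u).
Proof.
rewrite /lcontract tensm_compr -mrunit_tensV !compA (mid (isofK _)) compm1.
by rewrite (mid (esym (mrunitV_nat _ _))) !compA.
Qed.

(** This is the case B = 1 of contraction, up to an automorphism of the unit, which
    does not affect bijectivity. *)
Lemma left_dual_right_universal X' X (d : left_dual M X' X) A :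
  bijective (fun u : hom A X => dual_ev d \oc idm X' ## u).
Proof.
pose c := iso_comp (mrunit M 1) (iso_inv (mlunit M 1)).
apply: (eq_bij (bij_comp (postcomp_iso_bij c _)
  (bij_comp (lcontract_bij d A 1)
    (postcomp_iso_bij (iso_inv (mrunit M X)) A)))).
move=> u; rewrite /= lcontract_unit /= !compA.
by rewrite (mid (isofK _)) compm1 isovK comp1m.
Qed.

End Evaluation.

Section Pairing.
Variables (k : fieldType) (C : lincat k) (M : monoidal C).
Implicit Types X Y Z W A B : C.

Local Notation "X ** Y" := (tens M X Y) (at level 35).
Local Notation "f ## g" := (tensm M f g) (at level 35).
Local Notation "1" := (munit M).

Lemma left_dual_left_universal X' X (d : left_dual M X' X) A :
  bijective (fun u : hom A X' => dual_ev d \oc u ## idm X).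
Proof. exact: (left_dual_right_universal (rev_dual d) A). Qed.

(** Yoneda: a left dual of X is determined by the functor of pairings of X. *)
Lemma pairing_iso_left_dual X' X (d : left_dual M X' X) Z
    (e : hom (Z ** X) 1) :
  (forall A, bijective (fun u : hom A Z => e \oc u ## idm X)) ->
  exists s : iso Z X', dual_ev d \oc s ## idm X = e.
Proof.
move=> bij; have bijd := left_dual_left_universal d.
have [f _ fK] := bijd Z; have [g _ gK] := bij X'.
have E1 := fK e; have E2 := gK (dual_ev d); rewrite /= in E1 E2.
have fg : f e \oc g (dual_ev d) = idm X'.
  by apply: (bij_inj (bijd _)); rewrite tensm_compl compA E1 E2 tensm1 compm1.
have gf : g (dual_ev d) \oc f e = idm Z.
  by apply: (bij_inj (bij _)); rewrite tensm_compl compA E2 E1 tensm1 compm1.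
by exists (Iso gf fg).
Qed.

Section Perfect.
Variables (X' X : C) (d : left_dual M X' X) (Z : C) (e : hom (Z ** X) 1).
Hypothesis bij : forall A, bijective (fun u : hom A Z => e \oc u ## idm X).

(** By uniqueness of representations, e is the evaluation of the left dual X' up to
    an isomorphism of Z with X'. *)
Lemma pairing_lcontract_bij A B : bijective (@lcontract _ _ M Z X e A B).
Proof.
have [s sE] := pairing_iso_left_dual d bij.
apply: (eq_bij (bij_comp (precomp_iso_bij (fmap_iso (tens_right M A) s) B)
  (lcontract_bij d A B))).
move=> u /=.
rewrite -(lcontract_dinat (f := idm X) (evY := e)) ?tensm1 ?comp1m//.
by rewrite compm1.
Qed.

Lemma pairing_right_universal A :
  bijective (fun u : hom A X => e \oc idm Z ## u).
Proof.
have [s sE] := pairing_iso_left_dual d bij.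
apply: (eq_bij (bij_comp (precomp_iso_bij (fmap_iso (tens_right M A) s) 1)
  (left_dual_right_universal d A))).
by move=> u /=; rewrite (mid (tensm_rl _ _ _)) -sE (mid (tensm_lr _ _ _)).
Qed.

End Perfect.

End Pairing.

Section DualityConsequences.
Variables (k : fieldType) (C : lincat k) (M : monoidal C).
Implicit Types X Y Z W A B : C.

Local Notation "X ** Y" := (tens M X Y) (at level 35).
Local Notation "f ## g" := (tensm M f g) (at level 35).
Local Notation "1" := (munit M).

Lemma right_dual_unique Z X Y (dX : left_dual M Z X) (e : hom (Z ** Y) 1) :
  (forall A, bijective (fun u : hom A Y => e \oc idm Z ## u)) ->
  isomorphic X Y.
Proof.
move=> bij; apply: isomorphic_sym.
have [s _] :=
  @pairing_iso_left_dual _ _ (rev_monoidal M) _ _ (rev_dual dX) _ _ bij.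
by exists.
Qed.

(** The functor - (x) A is left adjoint to - (x) A' for A' left dual to A, and
    right adjoint to it for A' right dual to A. *)
Lemma epi_tens_right X Y A (A' : C) (d : left_dual M A' A) (f : hom X Y) :
  epi f -> epi (f ## idm A).
Proof.
move=> ef B a b; have [c _ cK] := rcontract_bij d Y B.
rewrite -(cK a) -(cK b) -!rcontract_natl => /(bij_inj (rcontract_bij d _ _)).
by move/ef->.
Qed.

Lemma mono_tens_right X Y A (A' : C) (d : left_dual M A A') (f : hom X Y) :
  mono f -> mono (f ## idm A).
Proof.
move=> mf B a b /(congr1 (fun u => rcontract (dual_ev d) u)).
by rewrite !rcontract_natr => /mf/(bij_inj (rcontract_bij d _ _)).
Qed.

End DualityConsequences.

(** * Tensor functors and the projection formula *)

Section Reversal.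
Variable k : fieldType.

Definition rev_rigid (C : lincat k) (M : monoidal C) (r : rigid M) :
    rigid (rev_monoidal M) :=
  @Rigid _ _ (rev_monoidal M) (rdual r) (fun X => rev_dual (rdualP r X))
    (ldual r) (fun X => rev_dual (ldualP r X)).

Definition rev_tensorCat (C : tensorCat k) : tensorCat k :=
  @TensorCat k C (tc_abelian C) (rev_monoidal C)
    (conj (fun X X' Y Y' f => (tc_bilinear C).2 _ _ _ _ f)
          (fun X X' Y Y' f => (tc_bilinear C).1 _ _ _ _ f))
    (rev_rigid C).

Variables (C D : tensorCat k) (F : tensorFunctor C D).

Fact rev_tf_assoc X Y Z :
  fmap F (isov (massoc C Z Y X)) \oc tf_mul F Z (tens C Y X)
    \oc tensm D (idm (F Z)) (tf_mul F Y X) =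
  tf_mul F (tens C Z Y) X \oc tensm D (tf_mul F Z Y) (idm (F X))
    \oc isov (massoc D (F Z) (F Y) (F X)).
Proof.
apply: (@iso_epi _ _ _ _ (massoc D (F Z) (F Y) (F X))).
rewrite (mid (isofK _)) compm1 -2!(compA (fmap F _)) -tf_assoc !compA.
by rewrite -fmapM isofK fmap1 comp1m.
Qed.

Definition rev_tensorFunctor :
    tensorFunctor (rev_tensorCat C) (rev_tensorCat D) :=
  @TensorFunctor k (rev_tensorCat C) (rev_tensorCat D) F (tf_linear F)
    (fun X Y => tf_mul F Y X) (tf_unit F)
    (fun X X' Y Y' f g => tf_mul_nat F g f) rev_tf_assoc
    (tf_runit F) (tf_lunit F).

End Reversal.

Section TensorFunctor.
Variables (k : fieldType) (C D : tensorCat k) (F : tensorFunctor C D).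

Local Notation "X *c Y" := (tens C X Y) (at level 35).
Local Notation "X *d Y" := (tens D X Y) (at level 35).
Local Notation "f #c g" := (tensm C f g) (at level 35).
Local Notation "f #d g" := (tensm D f g) (at level 35).
Local Notation mu := (tf_mul F).
Local Notation iota := (tf_unit F).

Lemma tf_mul_natl X X' Y (f : hom X X') :
  mu X' Y \oc fmap F f #d idm (F Y) = fmap F (f #c idm Y) \oc mu X Y.
Proof. by rewrite -tf_mul_nat fmap1. Qed.

Lemma tf_mul_natr X Y Y' (g : hom Y Y') :
  mu X Y' \oc idm (F X) #d fmap F g = fmap F (idm X #c g) \oc mu X Y.
Proof. by rewrite -tf_mul_nat fmap1. Qed.

Definition tf_ev X' X (ev : hom (X' *c X) (munit C)) :
    hom (F X' *d F X) (munit D) :=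
  isov iota \oc fmap F ev \oc mu X' X.

Definition tf_coev X' X (coev : hom (munit C) (X *c X')) :
    hom (munit D) (F X *d F X') :=
  isov (mu X X') \oc fmap F coev \oc iota.

Lemma tf_lunitV X :
  isov iota #d idm (F X) \oc isov (mu (munit C) X) \oc
    fmap F (isov (mlunit C X)) = isov (mlunit D (F X)).
Proof.
apply: (@iso_epi _ _ _ _ (mlunit D (F X))); rewrite isofK -tf_lunit !compA.
rewrite (mid (esym (fmapM F _ _))) isofK fmap1 compm1 (mid (isofK _)) compm1.
exact: tensl_isofK.
Qed.

(** Contraction involves one associativity and one left unit constraint, with
    which F is compatible. The morphism v is F(u) read in F(X) (x) F(B). *)
Lemma tf_lcontract X' X (ev : hom (X' *c X) (munit C)) A B
    (u : hom A (X *c B)) (v : hom (F A) (F X *d F B)) :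
  mu X B \oc v = fmap F u ->
  fmap F (lcontract ev u) \oc mu X' A = lcontract (tf_ev ev) v.
Proof.
move=> uv; rewrite /lcontract fmapM -compA -tf_mul_natr -uv tensm_compr !compA.
congr (_ \oc _); apply: (@iso_epi _ _ _ _ (massoc D (F X') (F X) (F B))).
rewrite (mid (isofK _)) compm1 -tf_lunit /tf_ev !tensm_compl !compA.
rewrite (mid (tensl_isovK _ _ _)) compm1 !fmapM.
rewrite (mid3 (esym (tf_assoc F _ _ _))) !compA (mid (esym (fmapM F _ _))).
rewrite isofK fmap1 compm1 (mid (tf_mul_natl _ _)) compA.
by [].
Qed.

Fact tf_zigzag X' X (d : left_dual C X' X) :
  mrunit D (F X) \oc idm (F X) #d tf_ev (dual_ev d)
    \oc massoc D (F X) (F X') (F X) \oc tf_coev (dual_coev d) #d idm (F X)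
    \oc isov (mlunit D (F X)) = idm (F X).
Proof.
rewrite -tf_lunitV -tf_runit /tf_ev /tf_coev !tensm_compr !tensm_compl.
rewrite !compA (mid (tensr_isovK _ _ _)) compm1 (mid (tensl_isovK _ _ _)).
rewrite compm1 (mid (tf_mul_natr _ _)) compA.
rewrite (mid3 (esym (tf_assoc F _ _ _))) !compA.
rewrite (mid (tensl_isovK _ _ _)) compm1.
rewrite (mid (tf_mul_natl _ _)) compA (mid (isovK _)) compm1.
by rewrite -!fmapM dual_zigzag_left fmap1.
Qed.

End TensorFunctor.

(** The second zigzag is the first one for the reversed tensor products. *)
Definition tf_dual (k : fieldType) (C D : tensorCat k) (F : tensorFunctor C D)
    X' X (d : left_dual C X' X) : left_dual D (F X') (F X) :=
  @LeftDual _ _ D _ _ (tf_ev F (dual_ev d)) (tf_coev F (dual_coev d))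
    (tf_zigzag F d) (tf_zigzag (rev_tensorFunctor F) (rev_dual d)).

Section Projection.
Variables (k : fieldType) (C D : tensorCat k) (F : tensorFunctor C D).
Variables (L : functor D C) (adj : adjunction L F).

Local Notation "X *c Y" := (tens C X Y) (at level 35).
Local Notation "X *d Y" := (tens D X Y) (at level 35).
Local Notation "f #c g" := (tensm C f g) (at level 35).
Local Notation "f #d g" := (tensm D f g) (at level 35).
Local Notation mu := (tf_mul F).
Local Notation eta := (adj_unit adj).

(** Transposition along L -| F; [sharp] below is its inverse. *)
Definition flat W X (f : hom (L W) X) : hom W (F X) := fmap F f \oc eta W.

Lemma flatE W X (f : hom (L W) X) : fmap F f \oc eta W = flat f.
Proof. by []. Qed.

Lemma flat_bij W X : bijective (@flat W X).
Proof. exact: adj_universal. Qed.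

Lemma flat_inj W X : injective (@flat W X).
Proof. exact: bij_inj (flat_bij W X). Qed.

Lemma flat_natl W W' X (f : hom (L W) X) (g : hom W' W) :
  flat (f \oc fmap L g) = flat f \oc g.
Proof. by rewrite /flat fmapM -!compA adj_unit_nat. Qed.

Lemma flat_natr W X X' (f : hom (L W) X) (g : hom X X') :
  flat (g \oc f) = fmap F g \oc flat f.
Proof. by rewrite /flat fmapM compA. Qed.

(** The projection map is given through its transpose
    F(A) (x) W -> F(A) (x) F(L(W)) = F(A (x) L(W)), by which all equations about it
    are checked. *)
Fact proj_map_exists A W :
  {f : hom (L (F A *d W)) (A *c L W) |
    flat f = mu A (L W) \oc idm (F A) #d eta W}.
Proof.
by apply: cid; have [g _ gK] := flat_bij (F A *d W) (A *c L W);
  eexists; apply: gK.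
Qed.

Definition proj_map A W := sval (proj_map_exists A W).

Lemma flat_proj_map A W :
  flat (proj_map A W) = mu A (L W) \oc idm (F A) #d eta W.
Proof. exact: svalP (proj_map_exists A W). Qed.

Lemma proj_map_natl A A' W (f : hom A A') :
  f #c idm (L W) \oc proj_map A W =
  proj_map A' W \oc fmap L (fmap F f #d idm W).
Proof.
apply: flat_inj; rewrite flat_natr flat_natl !flat_proj_map.
rewrite compA -tf_mul_natl -!compA; congr (_ \oc _).
by rewrite tensm_lr tensm_rl.
Qed.

Lemma proj_map_natr A W W' (g : hom W W') :
  idm A #c fmap L g \oc proj_map A W =
  proj_map A W' \oc fmap L (idm (F A) #d g).
Proof.
apply: flat_inj; rewrite flat_natr flat_natl !flat_proj_map.
rewrite compA -tf_mul_natr -!compA; congr (_ \oc _).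
by rewrite -!tensm_compr adj_unit_nat.
Qed.

(** The projection formula. A is the left dual of some B, so a morphism out of
    A (x) L(W) amounts to one from W to F(B (x) X) = F(B) (x) F(X), hence, F(A)
    being left dual to F(B), to one from F(A) (x) W to F(X). *)
Lemma proj_map_iso A W : exists i : iso (L (F A *d W)) (A *c L W),
  isof i = proj_map A W.
Proof.
apply: precomp_bij_iso => X.
have d := rdualP C A; set B := rdual C A in d.
apply: (bij_cancel_r (lcontract_bij d (L W) X)).
apply: (bij_cancel_l (flat_bij _ X)).
apply: (eq_bij (bij_comp (lcontract_bij (tf_dual F d) W (F X))
  (bij_comp (postcomp_iso_bij (iso_inv (mu B X)) W) (flat_bij W (B *c X))))).
move=> u /=; rewrite flat_natr flat_proj_map compA.
rewrite (tf_lcontract _ (v := isov (mu B X) \oc fmap F u)); last first.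
  by rewrite compA isovK comp1m.
by rewrite -lcontract_natl -compA.
Qed.

Definition proj_iso A W : iso (L (F A *d W)) (A *c L W) :=
  sval (cid (proj_map_iso A W)).

Lemma proj_isoE A W : isof (proj_iso A W) = proj_map A W.
Proof. exact: svalP (cid (proj_map_iso A W)). Qed.

End Projection.

(** * Duality between the left and the right adjoint *)

Section Adjoints.
Variables (k : fieldType) (C D : tensorCat k) (F : tensorFunctor C D).
Variables (L R : functor D C) (adjLF : adjunction L F) (adjFR : adjunction F R).

Local Notation "X *c Y" := (tens C X Y) (at level 35).
Local Notation "X *d Y" := (tens D X Y) (at level 35).
Local Notation "f #c g" := (tensm C f g) (at level 35).
Local Notation "f #d g" := (tensm D f g) (at level 35).
Local Notation mu := (tf_mul F).
Local Notation eta := (adj_unit adjLF).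
Local Notation eps := (adj_counit adjFR).
Local Notation flat := (flat adjLF).
Local Notation proj := (proj_map adjLF).

Definition sharp W X (v : hom W (F X)) : hom (L W) X :=
  locked (adj_counit adjLF X \oc fmap L v).

Lemma sharpK W X (v : hom W (F X)) : flat (sharp v) = v.
Proof.
rewrite /sharp -lock flat_natl -[RHS]comp1m; congr (_ \oc _).
exact: adj_triangle_right.
Qed.

Lemma sharp_bij W X : bijective (@sharp W X).
Proof.
exists (fun f => flat f) => [v|f]; first exact: sharpK.
by apply: (flat_inj (adj := adjLF)); rewrite sharpK.
Qed.

Lemma sharp_natl W W' X (v : hom W (F X)) (g : hom W' W) :
  sharp (v \oc g) = sharp v \oc fmap L g.
Proof. by rewrite /sharp -!lock fmapM compA. Qed.

Definition rproj_map W X : hom (L (W *d F X)) (L W *c X) :=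
  @proj_map _ _ _ (rev_tensorFunctor F) L adjLF X W.

Lemma flat_rproj_map W X :
  flat (rproj_map W X) = mu (L W) X \oc eta W #d idm (F X).
Proof. exact: (@flat_proj_map _ _ _ (rev_tensorFunctor F) L adjLF X W). Qed.

Lemma rproj_map_iso W X : exists i : iso (L (W *d F X)) (L W *c X),
  isof i = rproj_map W X.
Proof. exact: (@proj_map_iso _ _ _ (rev_tensorFunctor F) L adjLF X W). Qed.

(** The left and right projection maps commute: both composites have the same
    transpose because F is compatible with associativity. *)
Lemma proj_map_assoc A W X :
  massoc C A (L W) X \oc proj A W #c idm X \oc rproj_map (F A *d W) X =
  idm A #c rproj_map W X \oc proj A (W *d F X)
    \oc fmap L (massoc D (F A) W (F X)).
Proof.
apply: (flat_inj (adj := adjLF)).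
rewrite flat_natl -compA !flat_natr flat_proj_map flat_rproj_map !compA.
rewrite (mid (esym (tf_mul_natl _ _ _))) !compA.
rewrite (mid (esym (tensm_compl _ _ _ _))) flatE flat_proj_map.
rewrite tensm_compl !compA tf_assoc (mid (massoc_nat _ _ _ _)) !compA.
rewrite -tf_mul_natr [in RHS](mid (esym (tensm_compr _ _ _ _))) flatE.
by rewrite flat_rproj_map tensm_compr !compA.
Qed.

Lemma proj_map_assocV A W X :
  isov (massoc C A (L W) X) \oc idm A #c rproj_map W X \oc proj A (W *d F X) =
  proj A W #c idm X \oc rproj_map (F A *d W) X
    \oc fmap L (isov (massoc D (F A) W (F X))).
Proof.
apply: (@iso_epi _ _ _ _ (fmap_iso L (massoc D (F A) W (F X)))) => /=.
rewrite -compA (mid (esym (fmapM L _ _))) isofK fmap1 compm1 -!compA.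
rewrite (compA (idm A #c _)) -proj_map_assoc !compA.
by rewrite isofK comp1m.
Qed.

(** The map R(V) (x) L(W) = L(F(R(V)) (x) W) -> L(V (x) W) coming from the
    projection formula and the counit of F -| R. It is locked so that rewriting
    with associativity does not look inside. *)
Definition act V W : hom (R V *c L W) (L (V *d W)) :=
  locked (fmap L (eps V #d idm W) \oc isov (proj_iso adjLF (R V) W)).

Lemma act_proj_map X V W (u : hom X (R V)) :
  act V W \oc u #c idm (L W) \oc proj X W =
  fmap L ((eps V \oc fmap F u) #d idm W).
Proof.
rewrite -(compA (act V W)) proj_map_natl -proj_isoE /act -lock !compA.
by rewrite (mid (isofK _)) compm1 -fmapM -tensm_compl.
Qed.

Lemma act_proj V W : act V W \oc proj (R V) W = fmap L (eps V #d idm W).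
Proof.
by have := act_proj_map W (idm (R V)); rewrite tensm1 fmap1 !compm1.
Qed.

Lemma act_natl V V' W (g : hom V V') :
  act V' W \oc fmap R g #c idm (L W) = fmap L (g #d idm W) \oc act V W.
Proof.
apply: (@iso_epi _ _ _ _ (proj_iso adjLF (R V) W)).
rewrite proj_isoE act_proj_map -compA act_proj -fmapM -tensm_compl.
by rewrite adj_counit_nat.
Qed.

Lemma act_natr V W W' (g : hom W W') :
  act V W' \oc idm (R V) #c fmap L g = fmap L (idm V #d g) \oc act V W.
Proof.
apply: (@iso_epi _ _ _ _ (proj_iso adjLF (R V) W)).
rewrite proj_isoE -compA proj_map_natr compA act_proj -compA act_proj -!fmapM.
by rewrite tensm_swap.
Qed.

(** Followed by L(V (x) W) -> L(1) -> 1, [act] pairs R(V) with L(W). *)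
Definition dual_pairing V W (ev : hom (V *d W) (munit D)) :
    hom (R V *c L W) (munit C) :=
  locked (sharp (tf_unit F \oc ev) \oc act V W).

Lemma dual_pairing_natl V V' W (ev : hom (V *d W) (munit D)) (g : hom V' V) :
  dual_pairing ev \oc fmap R g #c idm (L W) =
  dual_pairing (ev \oc g #d idm W).
Proof.
by rewrite /dual_pairing -!lock -compA act_natl compA -sharp_natl compA.
Qed.

Lemma dual_pairing_natr V W W' (ev : hom (V *d W) (munit D)) (g : hom W' W) :
  dual_pairing ev \oc idm (R V) #c fmap L g =
  dual_pairing (ev \oc idm V #d g).
Proof.
by rewrite /dual_pairing -!lock -compA act_natr compA -sharp_natl compA.
Qed.

(** If V is left dual to W then R(V) is left dual to L(W): morphisms from X to
    R(V) correspond to those from F(X) to V, hence to pairings of F(X) with W,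
    hence by adjunction and the projection formula to pairings of X with
    L(W). *)
Lemma dual_pairing_universal V W (d : left_dual D V W) X :
  bijective (fun u : hom X (R V) =>
    dual_pairing (dual_ev d) \oc u #c idm (L W)).
Proof.
apply: (bij_cancel_l (precomp_iso_bij (proj_iso adjLF X W) _)).
apply: (bij_cancel_l (flat_bij adjLF _ _)).
apply: (eq_bij (bij_comp (postcomp_iso_bij (tf_unit F) _)
  (bij_comp (left_dual_left_universal d _) (adj_couniversal adjFR V X)))).
move=> u /=.
rewrite proj_isoE /dual_pairing -lock -2!(compA (sharp _)) act_proj_map.
by rewrite -sharp_natl sharpK compA.
Qed.

Definition dual_pairing_right_universal V W (d : left_dual D V W) :=
  pairing_right_universal (ldualP C (L W)) (dual_pairing_universal d).

Definition dual_pairing_lcontract_bij V W (d : left_dual D V W) :=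
  pairing_lcontract_bij (ldualP C (L W)) (dual_pairing_universal d).

(** By naturality it is enough to treat the identity of W (x) F(X), where the
    statement reduces to the commutation of the two projection maps. *)
Lemma sharp_lcontract V W (ev : hom (V *d W) (munit D)) Z X
    (h : hom Z (W *d F X)) :
  sharp (lcontract ev h) \oc act V Z =
  lcontract (dual_pairing ev) (rproj_map W X \oc fmap L h).
Proof.
rewrite -{1}(comp1m h) !lcontract_natl sharp_natl -compA -act_natr compA.
congr (_ \oc _).
apply: (@iso_epi _ _ _ _ (proj_iso adjLF (R V) (W *d F X))).
rewrite proj_isoE -compA act_proj -sharp_natl.
apply: (flat_inj (adj := adjLF)); rewrite sharpK.
rewrite /lcontract tensm1 compm1 -!compA (compA (isov _) (idm _ #c _)).
rewrite proj_map_assocV !compA (mid (esym (tensm_compl _ _ _ _))).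
rewrite /dual_pairing -lock -(compA (sharp _)) act_proj -sharp_natl.
rewrite flat_natl !flat_natr flat_rproj_map !compA.
rewrite fmapM (mid (esym (tf_mul_natl _ _ _))) !compA.
rewrite (mid (esym (tensm_compl _ _ _ _))) flatE sharpK -(compA (tf_unit F)).
rewrite tensm_compl !compA tf_lunit.
by rewrite (mid (massocV_natl _ _ _ _)) tensm_compl !compA.
Qed.

(** Given chi and a morphism 1 -> L(chi), the projection formula yields a
    morphism R(V) = R(V) (x) 1 -> R(V) (x) L(chi) -> L(V (x) chi). *)
Definition comparison chi (n : hom (munit C) (L chi)) V :
    hom (R V) (L (V *d chi)) :=
  act V chi \oc idm (R V) #c n \oc isov (mrunit C (R V)).

Lemma comparison_nat chi (n : hom (munit C) (L chi)) V V' (g : hom V V') :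
  comparison n V' \oc fmap R g = fmap L (g #d idm chi) \oc comparison n V.
Proof.
rewrite /comparison -compA mrunitV_nat !compA -act_natl.
by rewrite (mid (tensm_rl _ _ _)) (mid (tensm_lr _ _ _)).
Qed.

(** For W right dual to V, morphisms L(V (x) chi) -> X correspond to morphisms
    chi -> W (x) F(X), hence by universality of n to elements of
    L(W (x) F(X)) = L(W) (x) X, hence to morphisms R(V) -> X since R(V) is left
    dual to L(W). This composite bijection is precomposition with the
    comparison. *)
Lemma comparison_iso chi (n : hom (munit C) (L chi)) : universal n ->
  forall V, exists i : iso (R V) (L (V *d chi)), isof i = comparison n V.
Proof.
move=> univ V; apply: precomp_bij_iso => X.
have d := rdualP D V; set W := rdual D V in d.
have [i iE] := rproj_map_iso W X.
apply: (bij_cancel_r (sharp_bij _ _)).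
apply: (bij_cancel_r (lcontract_bij d chi (F X))).
apply: (eq_bij (bij_comp (precomp_iso_bij (iso_inv (mrunit C (R V))) X)
  (bij_comp (dual_pairing_lcontract_bij d _ X)
  (bij_comp (postcomp_iso_bij i _) (univ (W *d F X)))))).
move=> h /=; rewrite iE compA lcontract_natl -sharp_lcontract.
by rewrite /comparison !compA.
Qed.

Lemma universal_relative_modular chi (n : hom (munit C) (L chi)) :
  universal n -> is_relative_modular L R chi.
Proof.
move=> univ; pose i V := sval (cid (comparison_iso univ V)).
have iE V : isof (i V) = comparison n V := svalP (cid (comparison_iso univ V)).
exists; apply: (@NatIso _ _ _ R (L \oF tens_right D chi) i) => V V' g.
by rewrite !iE comparison_nat.
Qed.

(** The right adjoint of L(- (x) chi) is F(-) (x) chi^*. *)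
Lemma relative_modular_couniversal chi X :
  is_relative_modular L R chi ->
  exists e : hom (R (F X *d ldual D chi)) X, couniversal e.
Proof.
case=> i; pose Y := F X *d ldual D chi.
pose d := ldualP D chi.
exists (sharp (rcontract (dual_ev d) (idm Y)) \oc i Y) => V.
apply: (eq_bij (bij_comp (precomp_iso_bij (i V) X)
  (bij_comp (sharp_bij _ _) (rcontract_bij d V (F X))))).
move=> h /=; rewrite -compA [X in _ = _ \oc X](niso_nat i h) /= compA.
congr (_ \oc _).
by rewrite -sharp_natl -rcontract_natl comp1m.
Qed.

(** A couniversal arrow R(gamma) -> 1 corresponds to an element n of
    Hom(1, L(chi)), chi the right dual of gamma, under the pairing of R(gamma)
    with L(chi); for W with left dual V, both Hom(chi, W) = Hom(V, gamma) and
    Hom(1, L(W)) = Hom(R(V), 1). *)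
Lemma couniversal_universal gamma (c : hom (R gamma) (munit C)) :
  couniversal c -> exists chi (n : hom (munit C) (L chi)), universal n.
Proof.
move=> univ; pose chi := rdual D gamma; pose d := rdualP D gamma.
have [f _ fK] := dual_pairing_right_universal d (munit C).
(* n is the element of Hom(1, L(chi)) paired with R(gamma) to give c. *)
pose n := f (c \oc mrunit C _); exists chi, n => W.
have nE : dual_pairing (dual_ev d) \oc idm (R gamma) #c n = c \oc mrunit C _.
  exact: fK.
pose dW := ldualP D W; set V := ldual D W in dW.
have [t tK Kt] := left_dual_left_universal d V.
apply: (bij_cancel_l (dual_pairing_right_universal dW (munit C))).
apply: (bij_cancel_l (precomp_iso_bij (iso_inv (mrunit C (R V))) _)).
apply: (eq_bij (bij_comp (univ V) (bij_comp (bij_can_bij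
  (Bijective tK Kt) tK) (left_dual_right_universal dW chi)))) => h /=.
(* h' : V -> gamma is the dual of h. *)
set h' := t _.
have h'E : dual_ev d \oc h' #d idm chi = dual_ev dW \oc idm V #d h by exact: Kt.
rewrite tensm_compr compA dual_pairing_natr -h'E -dual_pairing_natl.
rewrite (mid (tensm_lr _ _ _)) -tensm_rl compA nE.
by rewrite (mid (mrunit_nat C _)) compA (mid (isovK _)) compm1.
Qed.

(** Both sides transpose to the contraction along the image pairing, followed by
    the unit of L -| F. *)
Lemma proj_lcontract A B (ev : hom (A *c B) (munit C)) W :
  lcontract ev (proj B W) \oc proj A (F B *d W) =
  fmap L (lcontract (tf_ev F ev) (idm (F B *d W))).
Proof.
apply: (flat_inj (adj := adjLF)); rewrite flat_natr flat_proj_map compA.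
pose v := isov (mu B (L W)) \oc fmap F (proj B W).
rewrite (tf_lcontract _ (v := v)); last by rewrite compA isovK comp1m.
rewrite -lcontract_natl /v -compA flatE flat_proj_map compA isofK comp1m.
by rewrite -[idm _ #d _]compm1 lcontract_natr adj_unit_nat.
Qed.

(** From 1 to X: for Y right dual to X, morphisms F(X) (x) chi -> W correspond
    to morphisms chi -> F(Y) (x) W, hence to elements of
    L(F(Y) (x) W) = Y (x) L(W), hence to morphisms X -> L(W). *)
Lemma universal_unit_universal chi (n : hom (munit C) (L chi)) X :
  universal n -> exists m : hom X (L (F X *d chi)), universal m.
Proof.
move=> univ.
exists (isov (proj_iso adjLF X chi) \oc idm X #c n \oc isov (mrunit C X)) => W.
pose d := rdualP C X; set Y := rdual C X in d.
apply: (bij_cancel_r (lcontract_bij (tf_dual F d) chi W)).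
apply: (eq_bij (bij_comp (precomp_iso_bij (iso_inv (mrunit C X)) _)
  (bij_comp (lcontract_bij d (munit C) (L W))
  (bij_comp (postcomp_iso_bij (proj_iso adjLF Y W) _) (univ (F Y *d W)))))).
move=> u /=; rewrite !compA; congr (_ \oc _).
rewrite !lcontract_natl; congr (_ \oc _).
apply: (@iso_epi _ _ _ _ (proj_iso adjLF X chi)).
rewrite (mid (isofK _)) compm1 !proj_isoE -compA proj_map_natr compA.
by rewrite proj_lcontract -fmapM -lcontract_natl comp1m.
Qed.

End Adjoints.

(** * Modules over a finite-dimensional algebra *)

Lemma linear_lfun (k : fieldType) (U V : vectType k) (f : U -> V) :
  linear f -> exists g : 'Hom(U, V), g =1 f.
Proof.
move=> linf.
pose h : {linear U -> V} := HB.pack f (GRing.isLinear.Build k U V *:%R f linf).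
by exists (linfun h) => x; rewrite lfunE.
Qed.

Section Modules.
Variables (k : fieldType) (A : fdalg k).

Lemma modhom_ext (M N : fdmod A) (f g : modhom M N) : f =1 g -> f = g.
Proof. by move=> fg; apply: val_inj; apply/lfunP. Qed.

Lemma modhom0E (M N : fdmod A) (m : M) : (0 : modhom M N) m = 0.
Proof. by rewrite zero_lfunE. Qed.

Lemma linear_modhom (M N : fdmod A) (f : M -> N) :
  linear f -> (forall m a, f (mact m a) = mact (f m) a) ->
  exists g : modhom M N, g =1 f.
Proof.
move=> /linear_lfun[g gE] fM.
have gP : g \in @modhom_pred k A M N.
  by apply/modhom_predP => m a; rewrite !gE fM.
by exists (ModHom gP).
Qed.

Definition regular_module : fdmod A :=
  @FdMod k A A (@amul k A) (fun m a b => esym (amulA m a b)) (@amula1 k A)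
    (@amul_linearl k A) (@amul_linearr k A).

Lemma regular_module_hom (M : fdmod A) (m : M) :
  exists f : modhom regular_module M, f (aone : A) = m.
Proof.
have [f fE] := @linear_modhom regular_module M _ (mact_linearr m)
  (fun a b => esym (mactA m a b)).
by exists f; rewrite fE mact1.
Qed.

Lemma regular_module_ext (M : fdmod A) (f g : modhom regular_module M) :
  f (aone : A) = g (aone : A) -> f = g.
Proof.
move=> fg; apply: modhom_ext => a; rewrite -(amul1a a).
by have /= -> := modhomP f aone a; have /= -> := modhomP g aone a; rewrite fg.
Qed.

Section Submodule.
Variables (N : fdmod A) (U : {vspace N}).
Hypothesis actU : forall n a, n \in U -> mact n a \in U.

Let sact (u : subvs_of U) (a : A) : subvs_of U := Subvs (actU a (subvsP u)).

Fact sactA u a b : sact (sact u a) b = sact u (amul a b).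
Proof. by apply: val_inj; rewrite /= mactA. Qed.

Fact sact1 u : sact u aone = u.
Proof. by apply: val_inj; rewrite /= mact1. Qed.

Fact sact_linearl a : linear (fun u => sact u a).
Proof. by move=> c u v; apply: val_inj; rewrite /= mact_linearl. Qed.

Fact sact_linearr u : linear (sact u).
Proof. by move=> c a b; apply: val_inj; rewrite /= mact_linearr. Qed.

Definition submodule : fdmod A :=
  @FdMod k A (subvs_of U) sact sactA sact1 sact_linearl sact_linearr.

End Submodule.

Lemma modhom_image (M N : fdmod A) (f : modhom M N) :
  exists (S : fdmod A) (i : modhom S N) (h : modhom M S),
    [/\ injective i, modcomp i h = f & limg i = limg f].
Proof.
have actU n a : n \in limg f -> mact n a \in limg f.
  by move=> /memv_imgP[m _ ->]; rewrite -modhomP memv_img ?memvf.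
pose S := submodule actU.
have [i iE] : exists i : modhom S N, i =1 vsval.
  by apply: linear_modhom => //; exact: linearP.
have [h hE] : exists h : modhom M S, h =1 (fun m => vsproj (limg f) (f m)).
  apply: linear_modhom => [c u v|m a]; first by rewrite !linearP.
  apply: val_inj; rewrite /= !vsprojK ?memv_img ?memvf //.
  by rewrite modhomP.
exists S, i, h; split.
- by move=> x y; rewrite !iE; apply: val_inj.
- apply: modhom_ext => m.
  by rewrite /= comp_lfunE iE hE vsprojK ?memv_img ?memvf.
apply/vspaceP => n; apply/memv_imgP/memv_imgP => -[x _ ->].
  by rewrite iE; have /memv_imgP[m _ ->] := subvsP x; exists m; rewrite ?memvf.
exists (h x); rewrite ?memvf // iE hE vsprojK ?memv_img ?memvf //.
Qed.

(** A maximal free family in the space of linear maps that consists of module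
    maps spans the module maps. *)
Lemma modhom_spanning (M N : fdmod A) :
  exists n (q : 'I_n -> modhom M N), forall f, exists c : 'I_n -> k,
    f = \sum_i c i *: q i.
Proof.
pose free_family n := `[< exists2 s : seq (modhom M N),
  size s = n & free [seq val g | g <- s] >].
have free0 : exists n, free_family n.
  by exists 0%N; apply/asboolP; exists [::] => //=; rewrite nil_free.
have bound n : free_family n -> (n <= \dim (fullv : {vspace 'Hom(M, N)}))%N.
  move=> /asboolP[s <- /eqP free_s]; rewrite -(size_map val) -free_s.
  by rewrite dimvS ?subvf.
have [n /asboolP[s size_s free_s] max_n] := ex_maxnP free0 bound.
have span_s (f : modhom M N) : val f \in <<[seq val g | g <- s]>>%VS.
  apply: contraT => f_s; suff : free_family n.+1 by move/max_n; rewrite ltnn.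
  apply/asboolP; exists (f :: s); first by rewrite /= size_s.
  by rewrite /= free_cons f_s.
pose t := in_tuple [seq val g | g <- s].
have size_t : size [seq val g | g <- s] = size s by rewrite size_map.
exists (size s), (fun i => s`_i) => f.
exists (fun i => coord t (cast_ord (esym size_t) i) (val f)).
apply: val_inj; rewrite [LHS](@coord_span _ _ _ t _ (span_s f)).
rewrite raddf_sum (reindex (cast_ord (esym size_t))) /=; last first.
  by exists (cast_ord size_t) => i _; rewrite (cast_ordK, cast_ordKV).
by apply: eq_bigr => i _; rewrite (nth_map 0).
Qed.

End Modules.

(** * Finite categories and right exact functors *)

Section Equivalence.
Variables (k : fieldType) (C M : lincat k) (F : functor C M) (G : functor M C).
Variables (a : natiso (G \oF F) (functor_id C)).
Variables (b : natiso (F \oF G) (functor_id M)).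

Lemma natiso_id_faithful (B : lincat k) (T : functor B B)
    (t : natiso T (functor_id B)) X Y (f g : hom X Y) :
  fmap T f = fmap T g -> f = g.
Proof.
move=> e; apply: (@iso_epi _ _ _ _ (t X)).
by rewrite -[LHS](niso_nat t f) e; exact: (niso_nat t g).
Qed.

Lemma equiv_faithful X Y (f g : hom X Y) : fmap F f = fmap F g -> f = g.
Proof. by move=> e; apply: (natiso_id_faithful a); rewrite /= e. Qed.

Lemma equiv_full X Y (h : hom (F X) (F Y)) : exists f, fmap F f = h.
Proof.
exists (a Y \oc fmap G h \oc isov (a X)).
apply: (natiso_id_faithful b) => /=; congr (fmap F _).
apply: (@iso_mono _ _ _ _ (a Y)).
have /= -> := niso_nat a (a Y \oc fmap G h \oc isov (a X)).
by rewrite -!compA isofK compm1.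
Qed.

End Equivalence.

Section ModuleEquivalence.
Variables (k : fieldType) (C : lincat k) (abC : abelian C).
Variables (A : fdalg k) (F : functor C (modcat A)) (G : functor (modcat A) C).
Hypothesis linF : linear_functor F.
Variables (a : natiso (G \oF F) (functor_id C)).
Variables (b : natiso (F \oF G) (functor_id (modcat A))).

(** The image of the corresponding module map is carried back to a subobject of Y,
    whose inclusion is mono and epi, hence invertible. *)
Lemma equiv_epi_surjective X Y (f : hom X Y) : epi f ->
  forall y : F Y, exists x : F X, fmap F f x = y.
Proof.
move=> ef y.
have [S [i [h [inj_i ihf limg_i]]]] :=
  @modhom_image k A (F X) (F Y) (fmap F f).
pose S' : modcat A := S.
pose i1 : hom S' (F Y) := i; pose h1 : hom (F X) S' := h.
have ih1 : i1 \oc h1 = fmap F f := ihf.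
have [i' i'E] := equiv_full a b (i1 \oc b S').
have [h' h'E] := equiv_full a b (isov (b S') \oc h1).
have i'h' : i' \oc h' = f.
  apply: (equiv_faithful a); rewrite fmapM i'E h'E compA.
  by rewrite (mid (isovK (b S'))) compm1.
have epi_i' : epi i' by apply: (@epi_compl _ _ _ _ _ i' h'); rewrite i'h'.
have mono_i : mono i1.
  move=> W u v e; apply: modhom_ext => w; apply: inj_i.
  have := congr1 (fun t : modhom _ _ => t w) e.
  by rewrite /= !comp_lfunE.
have mono_i' : mono i'.
  move=> W u v e; apply: (equiv_faithful a); apply: (@iso_mono _ _ _ _ (b S')).
  by apply: mono_i; rewrite !compA -!i'E -!fmapM e.
have [j jE] := mono_epi_iso abC mono_i' epi_i'.
have := congr1 (fmap F) (isovK j); rewrite fmapM fmap1 jE i'E -compA.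
move=> /(congr1 (fun t : modhom _ _ => t y)).
rewrite [LHS]/= comp_lfunE [RHS]id_lfunE => yE.
have : y \in limg i by rewrite -yE memv_img ?memvf.
by rewrite limg_i => /memv_imgP[x _ ->]; exists x.
Qed.

Lemma equiv_injective_mono X Y (f : hom X Y) :
  (forall x : F X, fmap F f x = 0 -> x = 0) -> mono f.
Proof.
move=> f0; apply: monoP => W g fg; apply: (equiv_faithful a).
have add0 := additive0 (linear_additive linF).
apply: modhom_ext => w; rewrite add0 modhom0E; apply: f0.
have := congr1 (fun t => (fmap F t : modhom _ _) w) fg.
by rewrite fmapM add0 modhom0E /= comp_lfunE.
Qed.

Lemma equiv_dim_le X Y (f : hom X Y) : epi f ->
  (\dim (fullv : {vspace F Y}) <= \dim (fullv : {vspace F X}))%N /\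
  (\dim (fullv : {vspace F X}) = \dim (fullv : {vspace F Y}) -> mono f).
Proof.
move=> ef; pose g : 'Hom(F X, F Y) := fmap F f : modhom _ _.
have limg_g : limg g = fullv.
  apply/eqP; rewrite eqEsubv subvf; apply/subvP => y _.
  by have [x <-] := equiv_epi_surjective ef y; rewrite memv_img ?memvf.
have := limg_ker_dim g fullv; rewrite limg_g capfv => dimE.
split=> [|dim_eq]; first by rewrite -dimE leq_addl.
have /eqP := dimE; rewrite dim_eq -[X in _ == X]add0n eqn_add2r dimv_eq0.
move=> /eqP ker0; apply: equiv_injective_mono => x fx.
by apply/eqP; rewrite -memv0 -ker0 memv_ker; apply/eqP.
Qed.

Lemma equiv_spanning (X Y : C) : exists n (q : 'I_n -> hom X Y), forall f,
  exists c : 'I_n -> k, f = \sum_i c i *: q i.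
Proof.
have [n [q qP]] := @modhom_spanning k A (F X) (F Y).
have [q' q'E] := choice (fun i => @equiv_full _ _ _ _ _ a b X Y (q i)).
exists n, q' => f; have [c cE] := qP (fmap F f); exists c.
apply: (equiv_faithful a); rewrite cE.
have add0 := additive0 (linear_additive linF).
have Fsum : fmap F (\sum_i c i *: q' i) = \sum_i fmap F (c i *: q' i).
  apply: (big_morph (fmap F)) => [x y|]; last exact: add0.
  exact: (linear_additive linF).
rewrite Fsum; apply: eq_bigr => i _; rewrite -q'E.
by have := linF (c i) (q' i) 0; rewrite !addr0 add0 addr0.
Qed.

Let P := G (regular_module A : modcat A).

Lemma generator_hom X (x : F X) : exists f : hom P X,
  (fmap F f \oc isov (b (regular_module A))) (aone : A) = x.
Proof.
have [m mE] := regular_module_hom x.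
pose R : modcat A := regular_module A.
pose m' : hom R (F X) := m.
have [f fE] := equiv_full a b (m' \oc b R).
by exists f; rewrite fE -compA (isovK (b R)) compm1.
Qed.

Lemma generator_ext X (f g : hom P X) :
  (fmap F f \oc isov (b (regular_module A))) (aone : A) =
  (fmap F g \oc isov (b (regular_module A))) (aone : A) -> f = g.
Proof.
move=> /regular_module_ext e; apply: (equiv_faithful a).
exact: (@isov_epi _ _ _ _ (b (regular_module A))).
Qed.

Lemma generator_projective : projective P.
Proof.
move=> X Y g f eg.
have [x xE] := equiv_epi_surjective eg
  ((fmap F f \oc isov (b (regular_module A))) (aone : A)).
have [h hE] := generator_hom x; exists h; apply: generator_ext.
by rewrite fmapM -compA -xE -hE /= !comp_lfunE.
Qed.

Lemma generator_cover (X : C) : exists n (p : 'I_n -> hom P X),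
  forall Y (t : hom X Y), (forall i, t \oc p i = 0) -> t = 0.
Proof.
pose e := vbasis (fullv : {vspace F X}).
have [p pE] := choice (fun i : 'I_(\dim (fullv : {vspace F X})) =>
  generator_hom e`_i).
exists (\dim (fullv : {vspace F X})), p => Y t tp.
have add0 := additive0 (linear_additive linF).
apply: (equiv_faithful a); apply: modhom_ext => x; rewrite add0.
rewrite (coord_vbasis (memvf x)) !linear_sum; apply: eq_bigr => i _.
rewrite !linearZ; congr (_ *: _); rewrite -pE.
have := congr1 (fun s => (fmap F s \oc isov (b (regular_module A)))
  (aone : A)) (tp i).
by rewrite fmapM /= !comp_lfunE add0 => ->; rewrite !lfunE.
Qed.

End ModuleEquivalence.

Section Finite.
Variables (k : fieldType) (C : lincat k) (abC : abelian C).
Hypothesis finC : finite_category C.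

Lemma finite_generator : exists P : C, projective P /\
  forall X : C, exists n (Q : C) (inj : 'I_n -> hom P Q) (prj : 'I_n -> hom Q P)
    (p : hom Q X),
    [/\ forall i, prj i \oc inj i = idm P,
        forall i j, i != j -> prj i \oc inj j = 0,
        \sum_i inj i \oc prj i = idm Q & epi p].
Proof.
have [A [F [G [linF [a] [b]]]]] := finC.
exists (G (regular_module A : modcat A)); split.
  exact: (generator_projective abC a b).
move=> X; have [n [p pP]] := generator_cover linF a b X.
have [Q [inj [prj [prjinj prjinj0 sumQ]]]] :=
  power_object abC (G (regular_module A : modcat A)) n.
exists n, Q, inj, prj, (\sum_i p i \oc prj i); split=> //.
apply: epiP => Y t tp; apply: pP => i.
have := congr1 (fun s => s \oc inj i) tp; rewrite comp0m => <-.
rewrite -compA comp_suml (bigD1 i) //= big1 => [|j ji].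
  by rewrite addr0 -compA prjinj compm1.
by rewrite -compA prjinj0 ?compm0.
Qed.

Lemma finite_enough_projectives (X : C) :
  exists (Q : C) (p : hom Q X), projective Q /\ epi p.
Proof.
have [P [projP genP]] := finite_generator.
have [n [Q [inj [prj [p [_ _ sumQ ep]]]]]] := genP X.
by exists Q, p; split=> //; apply: projective_power sumQ projP.
Qed.

(** The dimension of the corresponding module serves to choose minimal
    quotients. *)
Lemma finite_size : exists sz : C -> nat, forall (X Y : C) (f : hom X Y),
  epi f -> (sz Y <= sz X)%N /\ (sz X = sz Y -> mono f).
Proof.
have [A [F [G [linF [a] [b]]]]] := finC.
exists (fun X => \dim (fullv : {vspace F X})) => X Y f.
exact: (equiv_dim_le abC linF a b).
Qed.

Lemma finite_spanning (X Y : C) : exists n (q : 'I_n -> hom X Y), forall f,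
  exists c : 'I_n -> k, f = \sum_i c i *: q i.
Proof.
have [A [F [G [linF [a] [b]]]]] := finC.
exact: (equiv_spanning linF a b).
Qed.

End Finite.

Section RightExact.
Variables (k : fieldType) (C D : lincat k) (abC : abelian C) (abD : abelian D).
Variable (R : functor D C).
Hypothesis linR : linear_functor R.
Hypothesis kerR : forall (X Y K : D) (f : hom X Y) (i : hom K X),
  is_kernel f i -> is_kernel (fmap R f) (fmap R i).
Hypothesis epiR : forall (X Y : D) (f : hom X Y), epi f -> epi (fmap R f).

Let addR := linear_additive linR.

(** A morphism is epi onto the kernel of its cokernel, and R preserves
    epimorphisms and short exact sequences. *)
Lemma right_exact_cokernel (X Y Q : D) (f : hom X Y) (c : hom Y Q) :
  is_cokernel f c -> is_cokernel (fmap R f) (fmap R c).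
Proof.
move=> cokc; have [cf _] := cokc.
have [I [i keri]] := ab_ker abD c.
have [e [ie _]] := proj2 keri _ f cf.
have eR := epiR (image_epi abD cokc keri ie).
have [_ univ] :=
  epi_cokernel_of_kernel abC (epiR (cokernel_epi cokc)) (kerR keri).
split=> [|W g gf]; first by rewrite -fmapM cf (additive0 addR).
by apply: univ; apply: eR; rewrite comp0m -compA -fmapM ie.
Qed.

Lemma right_exact_factor (X Y Q : D) (f : hom X Y) (c : hom Y Q) Z
    (t : hom (R Y) Z) :
  is_cokernel f c -> t \oc fmap R f = 0 -> exists s, s \oc fmap R c = t.
Proof.
move=> /right_exact_cokernel[_ univ] tf.
by have [s [sE _]] := univ Z t tf; exists s.
Qed.

Hypotheses (finC : finite_category C) (finD : finite_category D).

(** An element t of Hom(R(Q), X) factors through a quotient g of Q of minimal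
    size; the resulting element of Hom(R(g), X) is killed by no nonzero morphism
    into g, since it would factor through a smaller quotient. *)
Lemma minimal_quotient (X : C) (Q : D) (t : hom (R Q) X) :
  exists (g : D) (p : hom Q g) (e : hom (R g) X), e \oc fmap R p = t /\
    forall K (d : hom K g), e \oc fmap R d = 0 -> d = 0.
Proof.
have [sz szP] := finite_size abD finD.
pose quot n := `[< exists (g : D) (p : hom Q g) (e : hom (R g) X),
  [/\ epi p, e \oc fmap R p = t & sz g = n] >].
have quot0 : exists n, quot n.
  exists (sz Q); apply/asboolP; exists Q, (idm Q), t.
  by split; [move=> W u v; rewrite !compm1 | rewrite fmap1 compm1 |].
have [n /asboolP[g [p [e [ep pt sz_g]]]] min_n] := ex_minnP quot0.
exists g, p, e; split=> // K d ed.
have [N [c cokc]] := ab_coker abD d.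
have [s sE] := right_exact_factor cokc ed.
have ec := cokernel_epi cokc.
have [le_sz eq_sz] := szP _ _ _ ec.
have le_n : (n <= sz N)%N.
  apply: min_n; apply/asboolP; exists N, (c \oc p), s; split=> //.
    exact: epi_comp.
  by rewrite fmapM compA sE.
have mc : mono c.
  by apply: eq_sz; apply/eqP; rewrite eqn_leq le_sz sz_g le_n.
by apply: mc; rewrite (proj1 cokc) compm0.
Qed.

(** With P a generator and q_1, ..., q_d spanning Hom(R(P), X), every element of
    every Hom(R(V), X) comes from (q_1, ..., q_d) in Hom(R(P^d), X) along a
    correspondence V <<- P^a -> P^d, so its reduction to a minimal quotient of P^d
    is couniversal. *)
Lemma right_exact_has_right_adjoint : has_right_adjoint R.
Proof.
apply: couniversal_right_adjoint => X.
have [P [_ genP]] := finite_generator abD finD.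
have [d [q qP]] := finite_spanning finC (R P) X.
have [Q [inj [prj [prjinj prjinj0 _]]]] := power_object abD P d.
pose t := \sum_j q j \oc fmap R (prj j).
have t_inj j : t \oc fmap R (inj j) = q j.
  rewrite /t comp_suml (bigD1 j) //= big1 => [|i ij].
    by rewrite addr0 -compA -fmapM prjinj fmap1 compm1.
  by rewrite -compA -fmapM prjinj0 // (additive0 addR) compm0.
have [g [p [e [ept e0]]]] := minimal_quotient t.
exists g, e => V.
suff ex v : exists h : hom V g, e \oc fmap R h = v.
  have [h hE] := choice ex; exists h => // f.
  apply/eqP; rewrite -subr_eq0; apply/eqP/e0.
  by rewrite (additiveB addR) compBr hE subrr.
have [a [Pa [inja [prja [pa [_ _ sum_a epa]]]]]] := genP V.
have [c cE] := choice (fun i => qP (v \oc fmap R pa \oc fmap R (inja i))).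
pose m := \sum_i (\sum_j c i j *: inj j) \oc prja i.
have Rsum I (r : seq I) (U W : D) (f : I -> hom U W) :
    fmap R (\sum_(i <- r) f i) = \sum_(i <- r) fmap R (f i).
  by apply: (big_morph (fmap R)) => [x y|]; [exact: addR | exact: additive0].
have Rscale (U W : D) b (f : hom U W) : fmap R (b *: f) = b *: fmap R f.
  by have := linR b f 0; rewrite (additive0 addR) !addr0.
have tm : t \oc fmap R m = v \oc fmap R pa.
  rewrite -[RHS]compm1 -fmap1 -sum_a !Rsum !comp_sumr.
  apply: eq_bigr => i _; rewrite !fmapM !compA cE; congr (_ \oc _).
  rewrite Rsum comp_sumr; apply: eq_bigr => j _.
  by rewrite Rscale compZr t_inj.
have [K [kap kerk]] := ab_ker abD pa.
have cokpa := epi_cokernel_of_kernel abD epa kerk.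
(* e detects that p m vanishes on the kernel of P^a ->> V, so that the
   correspondence V <<- P^a -> g is a morphism *)
have pm0 : p \oc m \oc kap = 0.
  apply: e0; rewrite 2!fmapM !compA ept tm -compA -fmapM (proj1 kerk).
  by rewrite (additive0 addR) compm0.
have [h [hE _]] := proj2 cokpa _ _ pm0.
exists h; apply: (epiR epa).
by rewrite -compA -fmapM hE fmapM compA ept.
Qed.

End RightExact.

(** * Exactness and the equivalence of the conditions *)

Section Exactness.
Variables (k : fieldType) (C D : lincat k).

Lemma exact_mono (abC : abelian C) (T : functor C D) X Y (f : hom X Y) :
  exact_functor T -> mono f -> mono (fmap T f).
Proof.
move=> [_ exT] mf; have [Q [c cokc]] := ab_coker abC f.
have kerf := mono_kernel_of_cokernel abC mf cokc.
by have [/kernel_mono] := exT _ _ _ _ _ (conj kerf cokc).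
Qed.

Lemma exact_epi (abC : abelian C) (T : functor C D) X Y (f : hom X Y) :
  exact_functor T -> epi f -> epi (fmap T f).
Proof.
move=> [_ exT] ef; have [K [i keri]] := ab_ker abC f.
have cokf := epi_cokernel_of_kernel abC ef keri.
by have [_ /cokernel_epi] := exT _ _ _ _ _ (conj keri cokf).
Qed.

Lemma middle_adjoint_exact (E G : functor D C) (T : functor C D) :
  linear_functor E -> linear_functor T -> linear_functor G ->
  adjunction E T -> adjunction T G -> exact_functor T.
Proof.
move=> linE linT linG adjET adjTG; split; first exact: linear_additive.
move=> X Y Z f g [kerf cokg]; split.
  by apply: (right_adjoint_kernel adjET) kerf; apply: linear_additive.
by apply: (left_adjoint_cokernel adjTG) cokg; apply: linear_additive.
Qed.

Lemma right_adjoint_epi_projective (F : functor C D) (R : functor D C)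
    (adj : adjunction F R) :
  (forall X Y (g : hom X Y), epi g -> epi (fmap R g)) ->
  forall P, projective P -> projective (F P).
Proof.
move=> epiR P projP X Y g f eg.
have [h hE] :=
  projP _ _ (fmap R g) (fmap R f \oc adj_unit adj P) (epiR _ _ g eg).
exists (adj_counit adj X \oc fmap F h).
rewrite compA -adj_counit_nat -compA -fmapM hE.
by rewrite fmapM compA adj_counit_nat -compA adj_triangle_left compm1.
Qed.

(** Cover R(Y) by a projective P; as F(P) is projective, the transpose F(P) -> Y of
    the covering lifts along g. *)
Lemma projective_right_adjoint_epi (F : functor C D) (R : functor D C)
    (adj : adjunction F R) :
  (forall X : C, exists (P : C) (p : hom P X), projective P /\ epi p) ->
  (forall P, projective P -> projective (F P)) ->
  forall X Y (g : hom X Y), epi g -> epi (fmap R g).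
Proof.
move=> enough projF X Y g eg.
have [P [p [projP ep]]] := enough (R Y).
have [h hE] := projF P projP X Y g (adj_counit adj Y \oc fmap F p) eg.
apply: (@epi_compl _ _ _ _ _ _ (fmap R h \oc adj_unit adj P)).
rewrite compA -fmapM hE fmapM -compA -adj_unit_nat compA.
by rewrite adj_triangle_right comp1m.
Qed.

End Exactness.

Section Equivalences.
Variables (k : fieldType) (C D : tensorCat k) (F : tensorFunctor C D).
Variables (L R : functor D C) (adjLF : adjunction L F) (adjFR : adjunction F R).

(** The unit 1 -> L(E(1)) is universal. *)
Lemma left_adjoint_relative_modular (E : functor C D) :
  adjunction E L -> is_relative_modular L R (E (munit C)).
Proof.
move=> adjEL.
exact: (universal_relative_modular adjLF adjFR (adj_universal adjEL (munit C))).
Qed.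

Lemma relative_modular_right_adjoint chi :
  is_relative_modular L R chi -> has_right_adjoint R.
Proof.
move=> modchi; apply: couniversal_right_adjoint => X.
exists (tens D (F X) (ldual D chi)).
exact: (relative_modular_couniversal adjLF X modchi).
Qed.

(** The couniversal arrow R(G(1)) -> 1 dualizes to a universal arrow
    1 -> L(chi), which propagates to all objects. *)
Lemma right_adjoint_left_adjoint : has_right_adjoint R -> has_left_adjoint L.
Proof.
move=> [G [adjRG]]; apply: universal_left_adjoint => X.
have [chi [n univ]] :=
  couniversal_universal adjLF adjFR (adj_couniversal adjRG (munit C)).
by exists (tens D (F X) chi); apply: universal_unit_universal univ.
Qed.

(** The couniversal object F(1) (x) chi^* = chi^* must be G(1). *)
Lemma relative_modular_dual (G : functor C D) chi : adjunction R G ->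
  is_relative_modular L R chi -> isomorphic chi (rdual D (G (munit C))).
Proof.
move=> adjRG modchi; apply: isomorphic_sym.
have [e univ] := relative_modular_couniversal adjLF (munit C) modchi.
have [s] := couniversal_unique (adj_couniversal adjRG (munit C)) univ.
pose i := iso_comp (mlunit D (ldual D chi)) (iso_comp
  (fmap_iso (tens_right D (ldual D chi)) (iso_inv (tf_unit F))) s).
apply: (right_dual_unique (rdualP D (G (munit C)))
  (e := dual_ev (ldualP D chi) \oc tensm D i (idm chi))) => A.
apply: (eq_bij (bij_comp (precomp_iso_bij (fmap_iso (tens_right D A) i) _)
  (left_dual_right_universal (ldualP D chi) A))) => u /=.
by rewrite (mid (tensm_rl _ _ _)) (mid (tensm_lr _ _ _)).
Qed.

Lemma relative_modular_unique chi chi' :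
  is_relative_modular L R chi -> is_relative_modular L R chi' ->
  isomorphic chi chi'.
Proof.
move=> m m'; have [G [adjRG]] := relative_modular_right_adjoint m.
apply: (isomorphic_trans (relative_modular_dual adjRG m)).
exact: isomorphic_sym (relative_modular_dual adjRG m').
Qed.

(** An epimorphism g of D has a monic right dual g'. As R(g) is the left dual of
    L(g'), cancelling R(g) on the right amounts to cancelling L(g') (x) X on the
    left. *)
Lemma left_mono_right_epi :
  (forall X Y (f : hom X Y), mono f -> mono (fmap L f)) ->
  forall X Y (g : hom X Y), epi g -> epi (fmap R g).
Proof.
move=> monoL V V1 g eg.
pose d := rdualP D V; pose d1 := rdualP D V1.
have [f _ fK] := left_dual_right_universal d (rdual D V1).
pose g' := f (dual_ev d1 \oc tensm D g (idm _)).
have g'E : dual_ev d \oc tensm D (idm V) g' = dual_ev d1 \oc tensm D g (idm _).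
  exact: fK.
have mg' : mono g'.
  move=> W x y xy; apply: (bij_inj (left_dual_right_universal d1 W)).
  apply: (epi_tens_right (ldualP D W) eg).
  rewrite /= -!compA !tensm_swap !compA -g'E.
  by rewrite -!compA -!tensm_compr xy.
move=> X a b ab.
apply: (@iso_epi _ _ _ _ (mrunit C (R V1))).
have bij1 := dual_pairing_lcontract_bij adjLF adjFR d1 (munit C) X.
have [h _ hK] := bij1; rewrite -(hK (a \oc _)) -(hK (b \oc _)); congr lcontract.
apply: (mono_tens_right (rdualP C X) (monoL _ _ _ mg')).
apply: (bij_inj (dual_pairing_lcontract_bij adjLF adjFR d (munit C) X)).
have dinat u : lcontract (dual_pairing adjLF adjFR (dual_ev d))
    (tensm C (fmap L g') (idm X) \oc u) =
    lcontract (dual_pairing adjLF adjFR (dual_ev d1)) u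
      \oc tensm C (fmap R g) (idm (munit C)).
  apply: lcontract_dinat.
  by rewrite dual_pairing_natr dual_pairing_natl g'E.
rewrite !dinat !hK.
by rewrite -!compA !mrunit_nat !compA ab.
Qed.

End Equivalences.

Theorem lemma4p3 (k : fieldType) (C D : tensorCat k) (F : tensorFunctor C D)
    (L R : functor D C) (adjLF : adjunction L F) (adjFR : adjunction F R) :
  (* (1) <-> (2) <-> (3) *)
  ((has_left_adjoint L <-> has_right_adjoint R) /\
   (has_right_adjoint R <-> exists chi : D, is_relative_modular L R chi)) /\
  (* uniqueness *)
  (forall chi chi' : D,
     is_relative_modular L R chi -> is_relative_modular L R chi' ->
     isomorphic chi chi') /\
  (forall (E G : functor C D) (chi : D),
     adjunction E L -> adjunction R G -> is_relative_modular L R chi ->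
     isomorphic (E (munit C)) chi /\
     isomorphic chi (rdual D (G (munit C)))) /\
  (* (1) <-> (4), (5), (6) in the finite case *)
  (finite_category C -> finite_category D ->
     (has_left_adjoint L <-> exact_functor L) /\
     (has_left_adjoint L <-> exact_functor R) /\
     (has_left_adjoint L <->
        (forall P : C, projective P -> projective (F P)))).
Proof.
have linF := tf_linear F.
have linL := left_adjoint_linear adjLF linF.
have linR := right_adjoint_linear adjFR linF.
have i13 : has_left_adjoint L -> exists chi : D, is_relative_modular L R chi.
  case=> E [adjEL]; exists (E (munit C)).
  exact: (left_adjoint_relative_modular adjLF adjFR adjEL).
have i32 : (exists chi : D, is_relative_modular L R chi) -> has_right_adjoint R.
  by case=> chi; apply: (relative_modular_right_adjoint adjLF).
have i21 : has_right_adjoint R -> has_left_adjoint L.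
  exact: (right_adjoint_left_adjoint adjLF adjFR).
split; first by split; split; auto.
split; first by move=> chi chi'; apply: (relative_modular_unique adjLF).
split.
  move=> E G chi adjEL adjRG modchi.
  split; last exact: (relative_modular_dual adjLF adjRG modchi).
  apply: (relative_modular_unique adjLF _ modchi).
  exact: (left_adjoint_relative_modular adjLF adjFR adjEL).
move=> finC finD.
have abC := tc_abelian C; have abD := tc_abelian D.
have i14 : has_left_adjoint L -> exact_functor L.
  case=> E [adjEL]; apply: (middle_adjoint_exact _ linL linF adjEL adjLF).
  exact: (left_adjoint_linear adjEL linL).
have i25 : has_right_adjoint R -> exact_functor R.
  case=> G [adjRG]; apply: (middle_adjoint_exact linF linR _ adjFR adjRG).
  exact: (right_adjoint_linear adjRG linR).
(* all conditions in the finite case are compared with this one *)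
pose epiR := forall X Y (g : hom X Y), epi g -> epi (fmap R g).
have i4e : exact_functor L -> epiR.
  move=> exL; apply: (left_mono_right_epi adjLF adjFR) => X Y f.
  exact: (exact_mono abD exL).
have i5e : exact_functor R -> epiR by move=> exR X Y g; apply: (exact_epi abD).
have ie2 : epiR -> has_right_adjoint R.
  move=> eR; apply: (right_exact_has_right_adjoint abC abD linR _ eR finC finD).
  move=> X Y K f i; apply: (right_adjoint_kernel adjFR);
    exact: linear_additive.
have ie6 : epiR -> forall P : C, projective P -> projective (F P).
  exact: (right_adjoint_epi_projective adjFR).
have i6e : (forall P : C, projective P -> projective (F P)) -> epiR.
  apply: (projective_right_adjoint_epi adjFR).
  exact: (finite_enough_projectives abC finC).
by split; [split|split; split]; auto.
Qed.
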